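(* Let $X$ be a random vector in $\mathbb{R}^k$ and, for each $\epsilon>0$, let $X_\epsilon$ be a random vector in $\mathbb{R}^k$ defined on the same probability space, with the same distribution as $X$, such that $\lim_{\epsilon\to0}X_\epsilon=X$ almost surely. Let $\sigma>0$ and let $Z$ be a normal random vector in $\mathbb{R}^k$ with mean zero and covariance matrix $\sigma^2 I_k$. Suppose there are a function $\lambda(\epsilon)>0$ and a random $k\times k$ real matrix $F$ such that the following conditions hold. (i) $\dfrac{1}{\lambda(\epsilon)}\,\mathbb{E}\left[X_\epsilon-X\,\middle|\,X\right]\longrightarrow -X$ in $L_1$ as $\epsilon\to0$. (ii) $\dfrac{1}{2\lambda(\epsilon)}\,\mathbb{E}\left[(X_\epsilon-X)(X_\epsilon-X)^T\,\middle|\,X\right]\longrightarrow \sigma^2I_k+\mathbb{E}\left[F\,\middle|\,X\right]$ in $L_1$ as $\epsilon\to0$. (iii) For each $\rho>0$, $\displaystyle\lim_{\epsilon\to0}\frac{1}{\lambda(\epsilon)}\,\mathbb{E}\left[|X_\epsilon-X|^2\,\mathbb{I}\left(|X_\epsilon-X|^2>\rho\right)\right]=0$. Then $$d_W(X,Z)\le\frac{1}{\sigma}\,\mathbb{E}\|F\|_{H.S.}.$$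
   Context: $|\cdot|$ is the Euclidean norm; $I_k$ is the $k\times k$ identity matrix; $\mathbb{I}(\cdot)$ is the indicator of an event; $\|A\|_{H.S.}=\sqrt{\operatorname{Tr}(AA^T)}$ is the Hilbert–Schmidt norm. $L_1$ convergence of random vectors and matrices is understood entrywise. The Wasserstein distance between random vectors $X,Y$ in $\mathbb{R}^k$ is $$d_W(X,Y)=\sup_{M_1(g)\le1}\left|\mathbb{E}g(X)-\mathbb{E}g(Y)\right|,\qquad M_1(g)=\sup_{x\ne y}\frac{|g(x)-g(y)|}{|x-y|},$$ the supremum being over functions $g:\mathbb{R}^k\to\mathbb{R}$ with Lipschitz constant $M_1(g)\le 1$. The random variables whose conditional expectations appear in the hypotheses (including $F$) are assumed integrable. *)

(* Defs.v *)
From HB Require Import structures.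
From mathcomp Require Import all_boot all_order all_algebra.
From mathcomp Require Import all_classical all_reals all_analysis.
Set Implicit Arguments.
Unset Strict Implicit.
Unset Printing Implicit Defensive.
Import Order.TTheory GRing.Theory Num.Theory.
Import numFieldNormedType.Exports.
Local Open Scope classical_set_scope.
Local Open Scope ring_scope.

(* Spaces of real matrices (in particular R^k, as column vectors) carry the
   Borel sigma-algebra, generated by the open sets of the entrywise topology. *)
Section borel_matrix.
Context (R : realType) (m n : nat).

Definition mx_borel : set (set 'M[R]_(m, n)) := <<s @open 'M[R]_(m, n) >>.

Lemma mx_borel0 : mx_borel set0.
Proof. exact: sigma_algebra0. Qed.

Lemma mx_borelC A : mx_borel A -> mx_borel (~` A).
Proof. exact: sigma_algebraC. Qed.

Lemma mx_borel_bigcup (A : (set 'M[R]_(m, n))^nat) :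
  (forall i, mx_borel (A i)) -> mx_borel (\bigcup_i A i).
Proof. exact: sigma_algebra_bigcup. Qed.

HB.instance Definition _ :=
  @isMeasurable.Build (sigma_display (@open 'M[R]_(m, n))) 'M[R]_(m, n)
    mx_borel mx_borel0 mx_borelC mx_borel_bigcup.

End borel_matrix.

(* The library norm of a matrix is the sup norm, so the Euclidean and the
   Hilbert-Schmidt norms are defined here. *)
Definition enorm (R : realType) (k : nat) (v : 'cV[R]_k) : R :=
  Num.sqrt (\sum_(i < k) v i 0 ^+ 2).

Definition hs_norm (R : realType) (k : nat) (A : 'M[R]_k) : R :=
  Num.sqrt (\tr (A *m A^T)).

Definition mx_integrable (d : measure_display) (T : measurableType d)
    (R : realType) (P : probability T R) (m n : nat) (Y : T -> 'M[R]_(m, n)) :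
    Prop :=
  forall i j, P.-integrable setT (fun w => (Y w i j)%:E).

(* C is a version of the conditional expectation E[Y | X], entrywise. *)
Definition is_cond_exp (d d' : measure_display) (T : measurableType d)
    (T' : measurableType d') (R : realType) (P : probability T R)
    (X : {RV P >-> T'}) (m n : nat) (Y C : T -> 'M[R]_(m, n)) : Prop :=
  forall i j,
    [/\ P.-integrable setT (fun w => (C w i j)%:E),
        measurable_fun (setT : set (g_sigma_algebra_preimageType X))
          (fun w => C w i j)
      & forall A : set T, g_sigma_algebra_preimage X A ->
          (\int[P]_(w in A) (C w i j)%:E = \int[P]_(w in A) (Y w i j)%:E)%E].

Definition cvg_L1_at0 (d : measure_display) (T : measurableType d)
    (R : realType) (P : probability T R) (m n : nat)
    (Y : R -> T -> 'M[R]_(m, n)) (L : T -> 'M[R]_(m, n)) : Prop :=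
  forall i j,
    'E_P[fun w => (`|Y eps w i j - L w i j|)%R]%E @[eps --> 0^'+] --> 0%E.

(* The law of n independent N(0, 1) coordinates. *)
Definition standard_normal_law (R : realType) (n : nat)
    (gamma : probability 'cV[R]_n R) : Prop :=
  forall B : 'I_n -> set R, (forall i, measurable (B i)) ->
    gamma [set x : 'cV[R]_n | forall i, B i (x i 0)] =
      (\prod_(i < n) normal_prob 0 1 (B i))%E.

(* Z is a normal vector with mean mu and covariance matrix S: its law is the
   image of a standard normal law under x |-> A x + mu for some A with
   A A^T = S. *)
Definition is_normal (d : measure_display) (T : measurableType d)
    (R : realType) (P : probability T R) (k : nat)
    (Z : {RV P >-> 'cV[R]_k}) (mu : 'cV[R]_k) (S : 'M[R]_k) : Prop :=
  exists (n : nat) (A : 'M[R]_(k, n)) (gamma : probability 'cV[R]_n R),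
    [/\ standard_normal_law gamma, A *m A^T = S
      & forall B : set 'cV[R]_k, measurable B ->
          distribution P Z B = gamma [set x : 'cV[R]_n | B (A *m x + mu)]].

(* Only measurable sets are compared: a measure is a total function on
   [set T], with no constraint on its values elsewhere. *)
Definition same_distribution (d1 d2 d' : measure_display)
    (T1 : measurableType d1) (T2 : measurableType d2) (T' : measurableType d')
    (R : realType) (P1 : probability T1 R) (P2 : probability T2 R)
    (X1 : {RV P1 >-> T'}) (X2 : {RV P2 >-> T'}) : Prop :=
  forall B : set T', measurable B ->
    distribution P1 X1 B = distribution P2 X2 B.

Definition M1 (R : realType) (k : nat) (g : 'cV[R]_k -> R) : \bar R :=
  ereal_sup [set (`|g xy.1 - g xy.2| / enorm (xy.1 - xy.2))%:E |
             xy in [set xy : 'cV[R]_k * 'cV[R]_k | xy.1 != xy.2]].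

Definition wasserstein (d1 d2 : measure_display)
    (T1 : measurableType d1) (T2 : measurableType d2)
    (R : realType) (P1 : probability T1 R) (P2 : probability T2 R) (k : nat)
    (X : {RV P1 >-> 'cV[R]_k}) (Y : {RV P2 >-> 'cV[R]_k}) : \bar R :=
  ereal_sup [set (`| 'E_P1[fun w => g (X w)] - 'E_P2[fun w => g (Y w)] |)%E |
             g in [set g : 'cV[R]_k -> R | (M1 g <= 1)%E]].

(* Main.v *)
(** Write [N = Z / sigma], a standard Gaussian vector, and for a 1-Lipschitz [g]
    interpolate by [h(t) = E g(cos t X + sigma sin t N)], the expectation in [N] being
    taken first: [h] goes from [E g(X)] at [t = 0] to [E g(Z)] at [t = pi/2].  After
    a small Gaussian smoothing of [g], [u_t(x) = E g(cos t x + sigma sin t N)] is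
    [C^2], and Gaussian integration by parts gives
      [h'(t) = tan t * E (sigma^2 Lap u_t(X) - X . grad u_t(X))].
    By exchangeability [E (u_t(X_eps) - u_t(X)) = 0]; expanding to second order,
    conditioning on [X], dividing by [lambda eps] and letting [eps] go to [0] turns
    the right-hand side into [- tan t * E Tr (F Hess u_t(X))].  Integrating by parts
    once more, and since [|grad g| <= 1],
      [|Tr (F Hess u_t)| <= cos^2 t / (sigma sin t) * ||F||],
    so that [|h'(t)| <= cos t / sigma * E ||F||], whose integral over [0, pi/2] is the
    claimed bound.  Everything about [N], the integration by parts included, is
    extracted from the Cameron-Martin formula
      [E phi(N + v) = E phi(N) exp(v . N - |v|^2 / 2)]. *)

From HB Require Import structures.
Require Import Defs.
From mathcomp Require Import all_boot all_order all_algebra.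
From mathcomp Require Import all_classical all_reals all_analysis.
From mathcomp Require Import measurable_realfun ring lra.
Set Implicit Arguments.
Unset Strict Implicit.
Unset Printing Implicit Defensive.
Import Order.TTheory GRing.Theory Num.Theory.
Import numFieldNormedType.Exports.
Local Open Scope classical_set_scope.
Local Open Scope ring_scope.

(** * Measures with a density *)

(** The Hessian bound that depends on [g] only through its Lipschitz constant blows up like
    [1 / sin t] at [t = 0], and the factor [tan t] absorbs exactly this singularity. Bounds on the
    second derivatives of the smoothed function degenerate with the smoothing; they justify limits
    and integrability but never enter the constant. The formula for [h'(t)] is available on the open
    interval only, because it divides by [cos t] and integrates by parts at scale [sigma sin t]; a
    mean value comparison with [sin t / sigma] asks for no more. Differentiability is encoded ([C1])
    by a quadratic error bound uniform in the base point: such a bound survives integration against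
    any law, is stable under Gaussian averaging, and yields a third-order Taylor remainder. That
    remainder is split at a level [t]: for [|d| <= t] it is [O(t |d|^2)], controlled by the trace of
    [hii]; beyond, it is controlled by [hiii]. First [eps], then [t], tends to [0]. [Z] lives on its
    own probability space, so expectations in [X] and [N] are iterated, and the integrability of [X]
    is extracted from [hi]. *)

Section density.
Context d (T : measurableType d) (R : realType).
Variables (mu nu : {measure set T -> \bar R}) (g : T -> R).
Hypothesis g0 : forall x, 0 <= g x.
Hypothesis mg : measurable_fun setT g.
Hypothesis nuE : forall A, measurable A -> nu A = (\int[mu]_(x in A) (g x)%:E)%E.
Import HBNNSimple.

(** Simple functions and monotone convergence on both sides. [nu] is tied to [g] through [nuE]
    alone, so the result covers [normal_prob] as well as [mdensity]. *)
Lemma ge0_integral_density (f : T -> \bar R) : (forall x, (0 <= f x)%E) ->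
  measurable_fun setT f ->
  (\int[nu]_x f x = \int[mu]_x (f x * (g x)%:E))%E.
Proof.
move=> f0 mf; pose h := nnsfun_approx measurableT mf.
have cvgh x : EFin (h n x) @[n --> \oo] --> f x by exact: cvg_nnsfun_approx.
have ndh x : {homo (fun n => h n x) : a b / (a <= b)%N >-> a <= b}.
  by move=> a b ab; exact/lefP/nd_nnsfun_approx.
have -> : (\int[nu]_x f x = limn (fun n => \int[nu]_x (h n x)%:E))%E.
  rewrite -monotone_convergence//.
  - by apply: eq_integral => x _; apply/esym/cvg_lim => //; exact: cvgh.
  - by move=> n; exact/measurable_EFinP.
  - by move=> n x _; rewrite lee_fin.
  - by move=> x _ a b ab; rewrite lee_fin; exact: ndh.
have -> : (\int[mu]_x (f x * (g x)%:E) =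
    limn (fun n => \int[mu]_x ((h n x)%:E * (g x)%:E)))%E.
  rewrite -monotone_convergence//.
  - apply: eq_integral => x _; apply/esym/cvg_lim => //.
    by apply: cvgeZr.
  - by move=> n; apply: emeasurable_funM => //; exact/measurable_EFinP.
  - by move=> n x _; rewrite mule_ge0// lee_fin.
  - by move=> x _ a b ab; rewrite lee_wpmul2r ?lee_fin //; exact: ndh.
congr (limn _); apply/funext => n.
transitivity (\int[nu]_x
   (\sum_(y \in range (h n)) (y * \1_(h n @^-1` [set y]) x)%:E))%E.
  by apply: eq_integral => t tE; rewrite /= fimfunE -fsumEFin.
have indich r : measurable_fun setT (fun x => (r * \1_(h n @^-1` [set r]) x)%:E).
  by apply/measurable_EFinP/measurable_funM.
rewrite ge0_integral_fsum//; last by move=> y x _; exact: nnfun_muleindic_ge0.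
transitivity (\int[mu]_x (\sum_(y \in range (h n))
    (y * \1_(h n @^-1` [set y]) x)%:E * (g x)%:E))%E; last first.
  apply: eq_integral => x _.
  rewrite -ge0_mule_fsuml => [|y]; last exact: nnfun_muleindic_ge0.
  by rewrite fsumEFin // -(fimfunE _ x).
rewrite ge0_integral_fsum//; last 2 first.
  - by move=> y; apply: emeasurable_funM; [exact: indich|exact/measurable_EFinP].
  - move=> y x _; rewrite mule_ge0 ?lee_fin ?g0//; exact: nnfun_muleindic_ge0.
apply: eq_fsbigr => r rhn.
under eq_integral do rewrite EFinM.
rewrite integralZl_indic_nnsfun => //.
under [RHS]eq_integral do rewrite EFinM -muleA.
rewrite ge0_integralZl//.
- rewrite integral_indic// setIT nuE//.
  rewrite integral_mkcond; congr (_ * _)%E; apply: eq_integral => x xE.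
  by rewrite epatch_indic muleC.
- by apply: emeasurable_funM => //; exact/measurable_EFinP.
- by move=> t Et; rewrite mule_ge0 ?lee_fin.
- by move: rhn; rewrite inE => -[t _ <-]; rewrite lee_fin.
Qed.

End density.

Section density_measure.
Context d (T : measurableType d) (R : realType).
Variables (mu : {measure set T -> \bar R}) (g : T -> R).
Hypotheses (g0 : forall x, 0 <= g x) (mg : measurable_fun setT g).

(** The two proofs are arguments so that the measure structure below attaches to the term
    [mdensity g0 mg] itself. *)
Definition mdensity of (forall x, 0 <= g x) & measurable_fun setT g :=
  fun A : set T => (\int[mu]_(x in A) (g x)%:E)%E.

Let mdensity0 : mdensity g0 mg set0 = 0%E.
Proof. by rewrite /mdensity integral_set0. Qed.

Let mdensity_ge0 A : (0 <= mdensity g0 mg A)%E.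
Proof. by apply: integral_ge0 => x _; rewrite lee_fin. Qed.

Let mdensity_sigma_additive : semi_sigma_additive (mdensity g0 mg).
Proof.
by apply: semi_sigma_additive_nng_induced => [|x];
  [exact/measurable_EFinP|rewrite lee_fin].
Qed.

HB.instance Definition _ := isMeasure.Build _ _ _ (mdensity g0 mg)
  mdensity0 mdensity_ge0 mdensity_sigma_additive.

Lemma ge0_integral_mdensity (f : T -> \bar R) : (forall x, (0 <= f x)%E) ->
  measurable_fun setT f ->
  (\int[mdensity g0 mg]_x f x = \int[mu]_x (f x * (g x)%:E))%E.
Proof. by move=> f0 mf; exact: ge0_integral_density. Qed.

End density_measure.

(** * Borel sets of matrices *)

Section borel_matrix_theory.
Context (R : realType) (m n : nat).
Implicit Types a y : 'M[R]_(m, n).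

(** The entrywise form of a sup-norm ball: it is visibly a finite product of intervals, which is
    what both measurability arguments exploit. *)
Definition mx_box a (r : R) : set 'M[R]_(m, n) :=
  [set y | forall i j, `|a i j - y i j| < r].

(** Second countability: an open set is a countable union of boxes with rational centres and radii
    [1 / (N + 1)]. It is stated for an arbitrary sigma-algebra [G] so as to serve as an induction
    principle for Borel sets. *)
Lemma open_mx_boxes (G : set (set 'M[R]_(m, n))) : sigma_algebra setT G ->
  (forall a r, G (mx_box a r)) -> @open 'M[R]_(m, n) `<=` G.
Proof.
move=> [G0 GC GU] Gbox U oU.
pose F (p : 'M[rat]_(m, n) * nat) : set 'M[R]_(m, n) :=
  let B := mx_box (map_mx ratr p.1) (p.2.+1%:R^-1) in
  if `[< B `<=` U >] then B else set0.
(* Codes that decode to no pair contribute the empty set, as do boxes not contained in [U]. *)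
pose A i := if unpickle i is Some p then F p else set0.
suff -> : U = \bigcup_i A i.
  by apply: GU => i; rewrite /A; case: unpickle => // p; rewrite /F; case: ifP.
apply/seteqP; split => y; last first.
  move=> [i _]; rewrite /A; case: unpickle => // p; rewrite /F.
  by case: ifPn => // /asboolP pU /pU.
move=> Uy.
have [e /= e0 yU] : exists2 e, 0 < e & ball y e `<=` U.
  by have /nbhs_ballP[e e0 yU] := open_nbhs_nbhs (conj oU Uy); exists e.
(* One [1 / (N + 1)] pays for moving from [y] to a rational centre, the other for the radius of the
   box. *)
have [N Ne] : exists N : nat, 2 * N.+1%:R^-1 < e.
  exists (Num.truncn (2 / e)).
  by rewrite ltr_pdivrMr// mulrC -ltr_pdivrMr// truncnS_gt.
have N0 : 0 < (N.+1%:R^-1 : R) by rewrite invr_gt0.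
have /choice[q hq] : forall p : 'I_m * 'I_n, exists q : rat,
    `|ratr q - y p.1 p.2| < N.+1%:R^-1.
  move=> p; have [q] : exists q : rat, ratr q \in
      `]y p.1 p.2 - N.+1%:R^-1, y p.1 p.2 + N.+1%:R^-1[.
    by apply: rat_in_itvoo; rewrite ltrD2l (lt_trans _ N0)// oppr_lt0.
  by rewrite in_itv/= -ltr_distl => ?; exists q.
exists (pickle ((\matrix_(i, j) q (i, j)), N)) => //.
rewrite /A pickleK /F; case: asboolP => [_|]/=.
  by move=> i j; rewrite !mxE; exact: hq (i, j).
apply => x xB; apply: yU; rewrite /ball/= /mx_ball; split => // i j.
rewrite /ball/=; apply: le_lt_trans Ne.
rewrite (le_trans (ler_distD (ratr (q (i, j))) _ _))// mulr_natl mulr2n lerD//.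
  by rewrite distrC ltW// (hq (i, j)).
by have := xB i j; rewrite !mxE => /ltW.
Qed.

Lemma continuous_mx_measurable (f : 'M[R]_(m, n) -> R) :
  continuous f -> measurable_fun setT f.
Proof.
move=> /continuousP cf; apply: (measurability _ (RGenOInfty.measurableE R)).
move=> _ [_ [r ->] <-]; rewrite setTI.
by apply: sub_sigma_algebra; apply: cf; exact: interval_open.
Qed.

Lemma measurable_mx_entry i j : measurable_fun setT (fun y => y i j).
Proof. by apply: continuous_mx_measurable => y; exact: coord_continuous. Qed.

(** The preimage of a box is a finite intersection of preimages of half-lines, and boxes suffice by
    [open_mx_boxes]. *)
Lemma measurable_fun_mx d (T : measurableType d) (f : T -> 'M[R]_(m, n)) :
  (forall i j, measurable_fun setT (fun t => f t i j)) -> measurable_fun setT f.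
Proof.
move=> mf; apply: (measurability (@open 'M[R]_(m, n))) => //.
move=> _ [B oB <-]; rewrite setTI.
pose G := [set U : set 'M[R]_(m, n) | measurable (f @^-1` U)].
suff : G B by [].
apply: open_mx_boxes oB; first split.
- by rewrite /G/= preimage_set0.
- by move=> A GA; rewrite /G/= setTD; apply: measurableC; exact: GA.
- by move=> A GA; rewrite /G/= preimage_bigcup; apply: bigcupT_measurable => i; exact: GA.
move=> a r; rewrite /G/=.
rewrite (_ : _ @^-1` _ = \bigcap_(p in [set: 'I_m * 'I_n])
   ((fun t => `|a p.1 p.2 - f t p.1 p.2|) @^-1` `]-oo, r[)); last first.
  apply/seteqP; split => t /= h; last first.
    by move=> i j; have := h (i, j) I; rewrite /= in_itv.
  by move=> [i j] _ /=; rewrite in_itv/=; exact: h.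
apply: fin_bigcap_measurable => // p _.
rewrite -[X in measurable X]setTI.
apply: (measurableT_comp (@normr_measurable _ setT)) => //.
exact: measurable_funB.
Qed.

End borel_matrix_theory.

(** * The Cameron-Martin formula *)

Section normal_shift.
Context (R : realType).
Local Notation mu := (@lebesgue_measure R).

(** The image of Lebesgue measure under a translation gives each half-open interval its length,
    hence is Lebesgue measure. *)
Lemma ge0_integral_lebesgue_shift (f : R -> \bar R) (h : R) :
  (forall x, (0 <= f x)%E) -> measurable_fun setT f ->
  (\int[mu]_x f (x + h)%R = \int[mu]_x f x)%E.
Proof.
move=> f0 mf.
have mh : measurable_fun [set: measurableTypeR R]
    (fun x : measurableTypeR R => (x + h : measurableTypeR R)).
  exact: measurable_funD.
pose s : {mfun (measurableTypeR R) >-> (measurableTypeR R)} :=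
  @mfun_Sub _ _ (measurableTypeR R) (measurableTypeR R) _ (mem_set mh).
rewrite -[LHS](@ge0_integral_pushforward _ _ _ _ _ _ mh mu setT)//.
apply: eq_measure_integral => A mA _; apply/esym.
apply: (@lebesgue_measure_unique R (pushforward mu s)) => // X [[a b] _ <-].
rewrite [RHS](_ : _ = mu `]a - h, b - h]%classic).
  rewrite !lebesgue_measure_itv/= !lte_fin ltrD2r; case: ifP => // _.
  by rewrite -!EFinB; congr EFin; ring.
congr (mu _); apply/seteqP; split => x /=; rewrite !in_itv/=.
  by rewrite ltrBlDr lerBrDr.
by rewrite ltrBlDr lerBrDr.
Qed.

(** Translate the Lebesgue integral by [h] and complete the square: [h (z + h) - h^2 / 2 - (z + h)^2
    / 2 = - z^2 / 2]. *)
Lemma normal_prob_shift (h : R) (A : set R) : measurable A ->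
  (\int[normal_prob 0 1]_(z in A) (expR (h * z - h ^+ 2 / 2))%:E =
   normal_prob 0 1 [set z : R | A (z + h)%R])%E.
Proof.
move=> mA.
have mE : measurable_fun setT (fun z : R => expR (h * z - h ^+ 2 / 2)).
  apply: measurableT_comp => //; apply: measurable_funB => /=; last exact: measurable_cst.
  by apply: measurable_funM => //; exact: measurable_cst.
rewrite integral_mkcond (@ge0_integral_density _ _ _ mu _ (normal_pdf 0 1)).
- rewrite [RHS]/normal_prob [RHS]integral_mkcond.
  rewrite -[LHS](@ge0_integral_lebesgue_shift _ h).
  + apply: eq_integral => z _; rewrite !patchE.
    have -> : (z \in [set z : R | A (z + h)]) = (z + h \in A).
      by apply/idP/idP => /set_mem ?; exact/mem_set.
    case: ifPn => _; last by rewrite mul0e.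
    rewrite -EFinM; congr EFin.
    rewrite !normal_pdfE ?oner_neq0// mulrCA; congr (_ * _).
    by rewrite /normal_fun -expRD; congr expR; field.
  + move=> z; rewrite patchE; case: ifPn => _; last by rewrite mul0e.
    by rewrite mule_ge0// lee_fin ?expR_ge0 ?normal_pdf_ge0.
  + apply: emeasurable_funM.
      apply/(measurable_restrictT _ _).1 => //.
      exact/measurable_EFinP/measurable_funTS.
    by apply/measurable_EFinP; exact: measurable_normal_pdf.
- exact: normal_pdf_ge0.
- exact: measurable_normal_pdf.
- by [].
- by move=> z; rewrite patchE; case: ifPn => // _; rewrite lee_fin expR_ge0.
- apply/(measurable_restrictT _ _).1 => //.
  exact/measurable_EFinP/measurable_funTS.
Qed.

End normal_shift.

(** * Translation of a standard Gaussian vector, one coordinate at a time *)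

Section gaussian_shift.
Context (R : realType) (n : nat) (gamma : probability 'cV[R]_n R).
Hypothesis gammaP : standard_normal_law gamma.

(** The pi-system on which [standard_normal_law] prescribes [gamma]. *)
Definition cV_rect : set (set 'cV[R]_n) :=
  [set B | exists2 S : 'I_n -> set R, (forall i, measurable (S i)) &
    B = [set y : 'cV[R]_n | forall i, S i (y i 0)]].

Lemma cV_rect_setI : setI_closed cV_rect.
Proof.
move=> _ _ [S mS ->] [S' mS' ->]; exists (fun i => S i `&` S' i).
  by move=> i; exact: measurableI.
apply/seteqP; split => y /=.
  by move=> [h h'] i; split.
by move=> h; split => i; have [] := h i.
Qed.

Lemma cV_rect_measurable : cV_rect `<=` measurable.
Proof.
move=> _ [S mS ->].
rewrite (_ : [set y : 'cV[R]_n | _] =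
   \bigcap_(i in [set: 'I_n]) ((fun y : 'cV[R]_n => y i 0) @^-1` S i)).
  apply: fin_bigcap_measurable => // i _.
  rewrite -[X in measurable X]setTI.
  by apply: (@measurable_mx_entry R n 1 i 0).
by apply/seteqP; split => y /= h => [i _|i]; [exact: h|exact: h].
Qed.

Lemma measurable_cV_rectE : @measurable _ 'cV[R]_n = <<s cV_rect >>.
Proof.
apply/seteqP; split; last first.
  apply: smallest_sub; last exact: cV_rect_measurable.
  split; [exact: measurable0|by move=> A; rewrite setTD; exact: measurableC|].
  by move=> A; exact: bigcupT_measurable.
have sG : sigma_algebra [set: 'cV[R]_n] <<s cV_rect >>.
  exact: smallest_sigma_algebra.
apply: smallest_sub => //; apply: open_mx_boxes => // a r.
apply: sub_sigma_algebra.
exists (fun i => [set z | `|a i 0 - z| < r]).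
  move=> i; rewrite (_ : [set z | _] = ball (a i 0) r); first exact: measurable_ball.
  by apply/seteqP; split.
apply/seteqP; split => y /= h => [i|i j]; first exact: h.
by rewrite (ord1 j).
Qed.

(** Only the [i]-th side of the rectangle moves; by the product formula the other sides contribute
    the common factor [c], which leaves the one-dimensional [normal_prob_shift]. *)
Lemma gaussian_shift_coord_rect (S : 'I_n -> set R) (i : 'I_n) (h : R) :
  (forall j, measurable (S j)) ->
  gamma [set y | forall j, S j ((y + h *: delta_mx i 0) j 0)] =
  (\int[gamma]_(y in [set y : 'cV[R]_n | forall j, S j (y j 0%R)])
     (expR (h * y i 0 - h ^+ 2 / 2))%:E)%E.
Proof.
move=> mS.
pose S' C j := if j == i then C else S j.
have mS' C : measurable C -> forall j, measurable (S' C j).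
  by move=> mC j; rewrite /S'; case: eqP.
pose c := (\prod_(j < n | j != i) normal_prob 0 1 (S j))%E.
have c0 : (0 <= c)%E by apply: prode_ge0.
have cfin : c \is a fin_num.
  by apply: prode_fin_num => j _; apply: fin_num_measure; exact: mS.
have gS' C : measurable C ->
    gamma [set y : 'cV[R]_n | forall j, S' C j (y j 0)] = (c * normal_prob 0 1 C)%E.
  move=> mC; rewrite gammaP; last exact: mS'.
  rewrite (bigD1 i)//= muleC /S' eqxx; congr (_ * _)%E.
  by apply: eq_bigr => j /negbTE ->.
have -> : [set y : 'cV[R]_n | forall j, S j ((y + h *: delta_mx i 0) j 0)] =
    [set y : 'cV[R]_n | forall j, S' [set z : R | S i (z + h)] j (y j 0)].
  apply/seteqP; split => y /= H j; have := H j; rewrite !mxE /S' eqxx andbT.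
    by case: eqP => [->|_]; rewrite ?mulr1// mulr0 addr0.
  by case: eqP => [->|_]; rewrite ?mulr1// mulr0 addr0.
rewrite gS'; last first.
  rewrite -[X in measurable X]setTI.
  by have := measurable_funD (@measurable_id _ R setT) (@measurable_cst _ _ _ _ setT h);
     apply => //; exact: mS.
rewrite -normal_prob_shift//.
(* [D] leaves coordinate [i] free. The image under coordinate [i] of [gamma] restricted to [D] is
   [c] times the normal law, which turns the integral over the rectangle into a one-dimensional
   one. *)
pose D := [set y : 'cV[R]_n | forall j, S' setT j (y j 0)].
have mD : measurable D.
  by apply: cV_rect_measurable; exists (S' setT) => //; exact: mS'.
have mD1 : measurable_fun setT (\1_D : 'cV[R]_n -> R) by exact: measurable_indic.
have D0 y : 0 <= (\1_D y : R) by rewrite indicE.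
pose k := mdensity gamma D0 mD1.
have mi : measurable_fun setT (fun y : 'cV[R]_n => (y i 0 : measurableTypeR R)).
  exact: measurable_mx_entry.
pose pi_i := @mfun_Sub _ _ 'cV[R]_n (measurableTypeR R) _ (mem_set mi).
pose e (z : R) := (expR (h * z - h ^+ 2 / 2))%:E.
have me : measurable_fun setT e.
  apply/measurable_EFinP.
  apply: measurableT_comp => //; apply: measurable_funB => /=; last exact: measurable_cst.
  by apply: measurable_funM => //; exact: measurable_cst.
have meS : measurable_fun setT (e \_ (S i)).
  apply/(measurable_restrictT _ _).1 => //; exact: measurable_funTS.
have eS0 z : (0 <= (e \_ (S i)) z)%E.
  by rewrite patchE; case: ifP => // _; rewrite lee_fin expR_ge0.
transitivity (\int[pushforward k pi_i]_z (e \_ (S i)) z)%E; last first.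
  rewrite (ge0_integral_pushforward mi)//.
  rewrite preimage_setT ge0_integral_mdensity//; last first.
    exact: measurableT_comp.
    by move=> y; exact: eS0.
  rewrite [RHS]integral_mkcond; apply: eq_integral => y _.
  rewrite /= !patchE indicE.
  have -> : (y \in [set y : 'cV[R]_n | forall j, S j (y j 0)]) =
            (y i 0 \in S i) && (y \in D).
    apply/idP/andP.
      move=> /set_mem /= H; split; apply/mem_set => //= j; rewrite /S'.
      by case: eqP.
    move=> [/set_mem Hi /set_mem H]; apply/mem_set => /= j.
    by have := H j; rewrite /S'; case: eqP => [->|].
  case: (y i 0 \in S i) => /=; last by rewrite mul0e.
  by case: (y \in D); rewrite ?mule1 ?mule0.
have cnn : 0 <= fine c by rewrite fine_ge0.
pose cN := mscale (NngNum cnn) (normal_prob (0:R) 1).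
transitivity (\int[cN]_z (e \_ (S i)) z)%E.
  rewrite ge0_integral_mscale//= fineK//.
  by rewrite [in LHS]integral_mkcond.
apply: (@eq_measure_integral _ (measurableTypeR R) R setT (pushforward k pi_i) cN)
  => C mC _.
transitivity (c * normal_prob (0:R) 1 C)%E.
  by rewrite -[in RHS](fineK cfin).
rewrite -gS'//.
transitivity (gamma (D `&` (pi_i @^-1` C))); last first.
  apply/esym/(integral_indic gamma _ mD).
  by rewrite -[X in measurable X]setTI; apply: (mi measurableT).
congr (gamma _); apply/seteqP; split => y /=.
  move=> H; split.
    by move=> j; have := H j; rewrite /S'; case: eqP.
  by have := H i; rewrite /S' eqxx.
move=> [H Hi] j; have := H j; rewrite /S'; case: eqP => [->|]//.
Qed.



Lemma measurable_cV_addr d (T : measurableType d) (f : T -> 'cV[R]_n) v :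
  measurable_fun setT f -> measurable_fun setT (fun t => f t + v).
Proof.
move=> mf; apply: measurable_fun_mx => i j.
under eq_fun do rewrite mxE.
apply: measurable_funD => //.
exact: (measurableT_comp (measurable_mx_entry i j) mf).
Qed.

(** The translate of [gamma] and the measure with the exponential density agree on rectangles, a
    pi-system that generates the Borel sets and contains the whole space. *)
Lemma gaussian_shift_coord (i : 'I_n) (h : R) (phi : 'cV[R]_n -> \bar R) :
  (forall y, (0 <= phi y)%E) -> measurable_fun setT phi ->
  (\int[gamma]_y phi (y + h *: delta_mx i 0)%R =
   \int[gamma]_y (phi y * (expR (h * y i 0%R - h ^+ 2 / 2))%:E))%E.
Proof.
move=> phi0 mphi.
pose g (y : 'cV[R]_n) := expR (h * y i 0 - h ^+ 2 / 2).
have g0 y : 0 <= g y by exact: expR_ge0.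
have mg : measurable_fun setT g.
  apply: measurableT_comp => //; apply: measurable_funB => /=; last exact: measurable_cst.
  by apply: measurable_funM; [exact: measurable_cst|exact: measurable_mx_entry].
have ms : measurable_fun setT (fun y : 'cV[R]_n => y + h *: delta_mx i 0).
  exact: measurable_cV_addr.
pose s := mfun_Sub (mem_set ms).
rewrite -(ge0_integral_mdensity gamma g0 mg)//.
transitivity (\int[pushforward gamma s]_y phi y)%E.
  by rewrite (ge0_integral_pushforward ms)//.
apply: eq_measure_integral => A mA _.
apply: (@measure_unique _ R 'cV[R]_n cV_rect (fun=> setT)) => //.
- exact: measurable_cV_rectE.
- exact: cV_rect_setI.
- by move=> _; exists (fun=> setT) => //; apply/seteqP; split.
- by apply/seteqP; split => // y _; exists 0%N.
- by move=> B [S mS ->]; exact: gaussian_shift_coord_rect.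
- by move=> _; apply: le_lt_trans (ltry 1); rewrite -(probability_setT gamma); exact: lexx.
Qed.

Lemma gaussian_shift (w : 'cV[R]_n) (phi : 'cV[R]_n -> \bar R) :
  (forall y, (0 <= phi y)%E) -> measurable_fun setT phi ->
  (\int[gamma]_y phi (y + w)%R = \int[gamma]_y
     (phi y * (expR (\sum_i (w i 0%R * y i 0%R - w i 0%R ^+ 2 / 2)))%:E))%E.
Proof.
pose W (s : seq 'I_n) := \sum_(i <- s) w i 0 *: (delta_mx i 0 : 'cV[R]_n).
pose E (s : seq 'I_n) (y : 'cV[R]_n) :=
  expR (\sum_(i <- s) (w i 0 * y i 0 - w i 0 ^+ 2 / 2)).
(* Induction on a duplicate-free list of the coordinates already shifted, with [phi] generalized
   because each step multiplies it by one exponential. *)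
suff shiftW s : uniq s -> forall phi : 'cV[R]_n -> \bar R,
    (forall y, (0 <= phi y)%E) -> measurable_fun setT phi ->
    (\int[gamma]_y phi (y + W s)%R = \int[gamma]_y (phi y * (E s y)%:E))%E.
  have wE : w = W (index_enum 'I_n).
    by rewrite {1}(matrix_sum_delta w); apply: eq_bigr => i _; rewrite big_ord1.
  by move=> phi0 mphi; rewrite {1}wE shiftW// index_enum_uniq.
elim: s => [_|i s IH /= /andP[si us]] {}phi phi0 mphi.
  apply: eq_integral => y _.
  by rewrite /W /E !big_nil addr0 expR0 mule1.
pose psi y := (phi y * (expR (w i 0 * y i 0 - w i 0 ^+ 2 / 2))%:E)%E.
have mpsi : measurable_fun setT psi.
  apply: emeasurable_funM => //; apply/measurable_EFinP.
  apply: measurableT_comp => //; apply: measurable_funB => /=; last exact: measurable_cst.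
  by apply: measurable_funM; [exact: measurable_cst|exact: measurable_mx_entry].
have psi0 y : (0 <= psi y)%E by rewrite mule_ge0// lee_fin expR_ge0.
transitivity (\int[gamma]_y psi (y + W s)%R)%E.
  under eq_integral do rewrite /W big_cons addrA.
  apply: etrans (gaussian_shift_coord i (w i 0)
    (phi := fun y => phi (y + W s)) _ _) _.
  - by move=> y; exact: phi0.
  - by apply: measurableT_comp => //; exact: measurable_cV_addr.
  apply: eq_integral => y _; rewrite /psi; congr (_ * _%:E)%E.
  (* Coordinate [i] is not in [s], so the later shifts leave the factor just produced unchanged. *)
  rewrite mxE [W s i 0](_ : _ = 0) ?addr0//.
  rewrite /W summxE big_seq big1// => j js; rewrite !mxE eqxx andbT.
  by case: eqP => [ij|_]; [rewrite ij js in si|rewrite mulr0].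
apply: etrans (IH us psi psi0 mpsi) _; apply: eq_integral => y _.
by rewrite /psi /E big_cons [in RHS]expRD EFinM muleA.
Qed.

End gaussian_shift.

(** * Real-valued expectations *)

Section expectation_toolkit.
Context d (T : measurableType d) (R : realType) (P : probability T R).
Implicit Types f g h : T -> R.

Definition itg f := P.-integrable setT (EFin \o f).
(** [Rintegral] sends an infinite integral to the default value [0], hence the [itg] premises of the
    rules below. *)
Definition Ex f : R := \int[P]_w f w.

Lemma itg_measurable f : itg f -> measurable_fun setT f.
Proof. by move=> /integrableP[/measurable_EFinP]. Qed.

Lemma Ex_EFin f : itg f -> (\int[P]_w (f w)%:E)%E = (Ex f)%:E.
Proof. by move=> If; rewrite /Ex /Rintegral fineK//; exact: integrable_fin_num. Qed.

Lemma eq_Ex f g : f =1 g -> Ex f = Ex g.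
Proof. by move=> /funext ->. Qed.

Lemma eq_itg f g : f =1 g -> itg f -> itg g.
Proof. by move=> /funext ->. Qed.

Lemma itg_cst c : itg (fun=> c).
Proof. exact: finite_measure_integrable_cst. Qed.

Lemma Ex_cst c : Ex (fun=> c) = c.
Proof.
rewrite [LHS](_ : _ = c * fine (P setT)); first by rewrite probability_setT mulr1.
exact: Rintegral_cst.
Qed.

Lemma itgD f g : itg f -> itg g -> itg (fun w => f w + g w).
Proof. by move=> If Ig; exact: (integrableD measurableT If Ig). Qed.

Lemma itgB f g : itg f -> itg g -> itg (fun w => f w - g w).
Proof. by move=> If Ig; exact: (integrableB measurableT If Ig). Qed.

Lemma itgZ c f : itg f -> itg (fun w => c * f w).
Proof. by move=> If; exact: (integrableZl measurableT c If). Qed.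

Lemma itgN f : itg f -> itg (fun w => - f w).
Proof. by move=> /(itgZ (-1)); apply: eq_itg => w; rewrite mulN1r. Qed.

Lemma itg_sum (I : Type) (s : seq I) (F : I -> T -> R) :
  (forall i, itg (F i)) -> itg (fun w => \sum_(i <- s) F i w).
Proof.
move=> IF; elim: s => [|i s IH].
  by apply: eq_itg (itg_cst 0) => w; rewrite big_nil.
by apply: eq_itg (itgD (IF i) IH) => w; rewrite big_cons.
Qed.

Lemma itg_norm f : itg f -> itg (fun w => `|f w|).
Proof. exact: integrable_norm. Qed.

Lemma itg_le g f : itg g -> measurable_fun setT f ->
  (forall w, `|f w| <= g w) -> itg f.
Proof.
move=> Ig mf fg; apply: (le_integrable measurableT _ _ Ig).
  exact/measurable_EFinP.
by move=> w _ /=; rewrite lee_fin (le_trans (fg w))// ler_norm.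
Qed.

Lemma itg_bounded c f : measurable_fun setT f -> (forall w, `|f w| <= c) -> itg f.
Proof. by move=> mf fc; exact: itg_le (itg_cst c) mf fc. Qed.

Lemma itgM_bounded c f h : itg f -> measurable_fun setT h ->
  (forall w, `|h w| <= c) -> itg (fun w => h w * f w).
Proof.
move=> If mh hc; apply: (itg_le (itgZ c (itg_norm If))).
  by apply: measurable_funM => //; exact: itg_measurable.
by move=> w; rewrite normrM ler_wpM2r.
Qed.

Lemma ExD f g : itg f -> itg g -> Ex (fun w => f w + g w) = Ex f + Ex g.
Proof. by move=> *; exact: RintegralD. Qed.

Lemma ExB f g : itg f -> itg g -> Ex (fun w => f w - g w) = Ex f - Ex g.
Proof. by move=> *; exact: RintegralB. Qed.

Lemma ExZ c f : itg f -> Ex (fun w => c * f w) = c * Ex f.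
Proof. by move=> *; exact: RintegralZl. Qed.


Lemma Ex_sum (I : Type) (s : seq I) (F : I -> T -> R) :
  (forall i, itg (F i)) ->
  Ex (fun w => \sum_(i <- s) F i w) = \sum_(i <- s) Ex (F i).
Proof.
move=> IF; elim: s => [|i s IH].
  by rewrite big_nil -[RHS](Ex_cst 0); apply: eq_Ex => w; rewrite big_nil.
rewrite big_cons -IH -ExD//; last exact: itg_sum.
by apply: eq_Ex => w; rewrite big_cons.
Qed.

Lemma Ex_ge0 f : (forall w, 0 <= f w) -> 0 <= Ex f.
Proof. by move=> f0; exact: Rintegral_ge0. Qed.

Lemma Ex_le f g : itg f -> itg g -> (forall w, f w <= g w) -> Ex f <= Ex g.
Proof. by move=> If Ig fg; apply: le_Rintegral. Qed.

Lemma Ex_norm_le g f : itg g -> measurable_fun setT f ->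
  (forall w, `|f w| <= g w) -> `|Ex f| <= Ex g.
Proof.
move=> Ig mf fg; have If := itg_le Ig mf fg.
apply: le_trans (le_normr_Rintegral _ If) _ => //.
by apply: Ex_le => //; exact: itg_norm.
Qed.

End expectation_toolkit.

(** * Functions with a Lipschitz gradient *)

Lemma cvg_sumr (R : realType) (I T : Type) (F : set_system T) (r : seq I)
    (f : I -> T -> R) (a : I -> R) {FF : Filter F} :
  (forall i, f i x @[x --> F] --> a i) ->
  \sum_(i <- r) f i x @[x --> F] --> \sum_(i <- r) a i.
Proof. by move=> fa; apply: cvg_big => //; exact: add_continuous. Qed.

Section dot.
Context (R : realType) (k : nat).
Implicit Types u v w : 'cV[R]_k.

Definition dot u v : R := \sum_i u i 0 * v i 0.
Definition nsq v : R := dot v v.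

Lemma dotC u v : dot u v = dot v u.
Proof. by apply: eq_bigr => i _; rewrite mulrC. Qed.

Lemma dotDl u v w : dot (u + v) w = dot u w + dot v w.
Proof. by rewrite /dot -big_split; apply: eq_bigr => i _; rewrite mxE mulrDl. Qed.

Lemma dotDr u v w : dot u (v + w) = dot u v + dot u w.
Proof. by rewrite dotC dotDl dotC [dot w u]dotC. Qed.

Lemma dotZl c u v : dot (c *: u) v = c * dot u v.
Proof. by rewrite /dot mulr_sumr; apply: eq_bigr => i _; rewrite mxE mulrA. Qed.

Lemma dotNl u v : dot (- u) v = - dot u v.
Proof. by rewrite -scaleN1r dotZl mulN1r. Qed.

Lemma dotZr c u v : dot u (c *: v) = c * dot u v.
Proof. by rewrite dotC dotZl dotC. Qed.

Lemma dot0r u : dot u 0 = 0.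
Proof. by rewrite /dot big1// => i _; rewrite mxE mulr0. Qed.

Lemma nsq0 : nsq 0 = 0.
Proof. exact: dot0r. Qed.

Lemma nsqE v : nsq v = \sum_i v i 0 ^+ 2.
Proof. by apply: eq_bigr => i _; rewrite expr2. Qed.

Lemma nsq_ge0 v : 0 <= nsq v.
Proof. by rewrite nsqE sumr_ge0// => i _; rewrite sqr_ge0. Qed.

Lemma nsqZ c v : nsq (c *: v) = c ^+ 2 * nsq v.
Proof. by rewrite /nsq dotZl dotZr mulrA expr2. Qed.

Lemma nsqN v : nsq (- v) = nsq v.
Proof. by rewrite -scaleN1r nsqZ sqrrN expr1n mul1r. Qed.

Lemma sqr_le_nsq v i : v i 0 ^+ 2 <= nsq v.
Proof.
by rewrite nsqE (bigD1 i)//= lerDl sumr_ge0// => j _; rewrite sqr_ge0.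
Qed.

Lemma nsq_eq0 v : (nsq v == 0) = (v == 0).
Proof.
apply/eqP/eqP => [v0|->].
  apply/matrixP => i j; rewrite ord1 mxE; apply/eqP.
  by rewrite -sqrf_eq0 eq_le sqr_ge0 andbT -v0 sqr_le_nsq.
by rewrite nsqE big1// => i _; rewrite mxE expr0n.
Qed.

Lemma sqr_enorm v : enorm v ^+ 2 = nsq v.
Proof.
by rewrite /enorm sqr_sqrtr ?nsqE// sumr_ge0// => i _; rewrite sqr_ge0.
Qed.

Lemma enorm_ge0 v : 0 <= enorm v.
Proof. exact: sqrtr_ge0. Qed.

Lemma enormZ c v : enorm (c *: v) = `|c| * enorm v.
Proof.
by apply/eqP; rewrite -(@eqrXn2 _ 2)// ?mulr_ge0 ?enorm_ge0// exprMn !sqr_enorm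
  nsqZ real_normK ?num_real.
Qed.


Lemma le_enorm v i : `|v i 0| <= enorm v.
Proof.
by rewrite -ler_sqr ?nnegrE ?enorm_ge0// sqr_enorm real_normK ?num_real// sqr_le_nsq.
Qed.

(** From [(|v| - 1)^2 >= 0]; crude, but enough to deduce integrability of a norm from a second
    moment. *)
Lemma enorm_le_nsq v : enorm v <= 1 + nsq v.
Proof.
rewrite -sqr_enorm; have := sqr_ge0 (enorm v - 1); have := enorm_ge0 v.
by set e := enorm v => e0; nra.
Qed.

Lemma enorm_le_sum v : enorm v <= \sum_i `|v i 0|.
Proof.
have S0 : 0 <= \sum_i `|v i 0| by exact: sumr_ge0.
rewrite -ler_sqr ?nnegrE ?enorm_ge0// sqr_enorm nsqE.
rewrite [leRHS]expr2 mulr_suml ler_sum// => i _.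
rewrite -(real_normK (num_real (v i 0))) expr2 ler_wpM2l// (bigD1 i)//= lerDl; exact: sumr_ge0.
Qed.

Lemma dot_delta u i : dot u (delta_mx i 0) = u i 0.
Proof.
rewrite /dot (bigD1 i)//= mxE !eqxx mulr1 big1 ?addr0// => j /negbTE ji.
by rewrite mxE ji mulr0.
Qed.

Lemma nsq_delta i : nsq (delta_mx i 0) = 1.
Proof. by rewrite /nsq dot_delta mxE !eqxx. Qed.

Lemma enorm_delta i : enorm (delta_mx i 0 : 'cV[R]_k) = 1.
Proof.
by apply/eqP; rewrite -(@eqrXn2 _ 2)// ?enorm_ge0// sqr_enorm nsq_delta expr1n.
Qed.

Lemma continuous_dot u : continuous (dot u).
Proof.
move=> v; apply: (@cvg_sumr _ _ _ (nbhs v)) => i; apply: cvgM; first exact: cvg_cst.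
exact: coord_continuous.
Qed.

Lemma continuous_nsq : continuous nsq.
Proof.
move=> v; apply: (@cvg_sumr _ _ _ (nbhs v)) => i; apply: cvgM; exact: coord_continuous.
Qed.

(* Uniform C^{1,1} regularity: [q] is the gradient of [phi], with a quadratic
   error on a ball whose radius does not depend on the centre. *)
Definition C1 (phi : 'cV[R]_k -> R) (q : 'cV[R]_k -> 'cV[R]_k) : Prop :=
  exists C r : R, 0 < r /\ forall y d, nsq d <= r ->
    `|phi (y + d) - phi y - dot (q y) d| <= C * nsq d.

Lemma C1Z c phi q : C1 phi q -> C1 (fun y => c * phi y) (fun y => c *: q y).
Proof.
move=> [C [r [r0 H]]]; exists (`|c| * C), r; split=> // y d dr.
rewrite dotZl -!mulrBr normrM -mulrA ler_wpM2l//; exact: H.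
Qed.

(** Recovers the gradient as a limit along a sequence; this gives its uniqueness, its measurability,
    and its bound by the Lipschitz constant. *)
Lemma C1_cvg_dir phi q : C1 phi q -> forall y w,
  n.+1%:R * (phi (y + n.+1%:R^-1 *: w) - phi y) @[n --> \oo] --> dot (q y) w.
Proof.
move=> [C [r [r0 H]]] y w; apply/cvgrPdist_le => e e0.
(* Threshold for [1 / (n + 1)]: below it the increment lies within the radius [r], and the error of
   the quotient, at most [C |w|^2 / (n + 1)], is at most [e]. The added [1]s guard against zero
   denominators. *)
have eta0 : 0 < Num.min r (e / (`|C| + 1)) / (nsq w + 1).
  by rewrite divr_gt0 ?lt_min ?r0 ?divr_gt0// ?ltr_wpDl// nsq_ge0.
near=> n.
have n0 : 0 < n.+1%:R^-1 :> R by rewrite invr_gt0.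
have hn : n.+1%:R^-1 * nsq w <= Num.min r (e / (`|C| + 1)).
  have : n.+1%:R^-1 <= Num.min r (e / (`|C| + 1)) / (nsq w + 1).
    by near: n; by apply: filterS (near_infty_natSinv_lt (PosNum eta0)) => m /ltW.
  rewrite ler_pdivlMr ?ltr_wpDl ?nsq_ge0//; apply: le_trans.
  by rewrite ler_wpM2l ?(ltW n0)// lerDl.
have n1 : n.+1%:R^-1 <= 1 :> R by rewrite invf_le1// ler1n.
have /H : nsq (n.+1%:R^-1 *: w) <= r.
  move: hn; rewrite le_min => /andP[+ _]; apply: le_trans.
  by rewrite nsqZ expr2 -mulrA ler_piMl// mulr_ge0 ?nsq_ge0// (ltW n0).
move=> /(_ y); rewrite dotZr nsqZ => Hn.
have -> : dot (q y) w - n.+1%:R * (phi (y + n.+1%:R^-1 *: w) - phi y) =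
   - (n.+1%:R * (phi (y + n.+1%:R^-1 *: w) - phi y - n.+1%:R^-1 * dot (q y) w)).
  by field; rewrite addrC natr1 pnatr_eq0.
rewrite normrN normrM ger0_norm ?ler0n//.
rewrite -ler_pdivlMl ?ltr0n//; apply: le_trans Hn _.
rewrite expr2 -mulrA mulrCA ler_wpM2l ?(ltW n0)//.
move: hn; rewrite le_min => /andP[_].
rewrite ler_pdivlMr ?ltr_wpDl// => hn; apply: le_trans hn; rewrite mulrC.
by rewrite ler_wpM2l ?mulr_ge0 ?nsq_ge0 ?(ltW n0)// (le_trans (ler_norm _))// lerDl.
Unshelve. all: end_near. Qed.

Lemma C1_unique phi q q' : C1 phi q -> C1 phi q' -> q = q'.
Proof.
move=> H H'; apply/funext => y; apply/matrixP => i j; rewrite ord1.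
rewrite -!dot_delta; apply: (cvg_unique _ (C1_cvg_dir H (w := _)) (C1_cvg_dir H' (w := _))).
exact: norm_hausdorff.
Qed.

Lemma C1_continuous phi q : C1 phi q -> continuous phi.
Proof.
move=> [C [r [r0 H]]] y.
apply/(@cvgrPdist_le _ _ _ (nbhs y)) => e e0.
have sub0 : x - y @[x --> y] --> (0 : 'cV[R]_k).
  by rewrite -(subrr y); apply: (@cvgB R 'cV[R]_k _ (nbhs y) _ id (cst y) y y);
    [exact: cvg_id|exact: cvg_cst].
have nsq0 : nsq (x - y) @[x --> y] --> 0.
  rewrite -[X in _ --> X](_ : nsq (0 : 'cV[R]_k) = 0); last first.
    by apply/eqP; rewrite nsq_eq0.
  by apply: cvg_comp sub0 _; exact: continuous_nsq.
have Cnsq0 : C * nsq (x - y) @[x --> y] --> 0.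
  by rewrite -(mulr0 C); apply: (@cvgM _ _ (nbhs y)); [exact: cvg_cst|exact: nsq0].
have dot0 : dot (q y) (x - y) @[x --> y] --> 0.
  rewrite -[X in _ --> X](_ : dot (q y) 0 = 0); last first.
    by rewrite -(scale0r 0) dotZr mul0r.
  by apply: cvg_comp sub0 _; exact: continuous_dot.
near=> x.
have -> : phi y - phi x = - ((phi (y + (x - y)) - phi y - dot (q y) (x - y))
   + dot (q y) (x - y)) by rewrite [y + _]addrC !subrK opprB.
rewrite normrN (le_trans (ler_normD _ _))// [e]splitr lerD//.
  apply: le_trans (H _ _ _) _.
    by near: x; apply: (cvgr_le 0).
  by near: x; apply: (cvgr_le 0) => //; exact: divr_gt0.
by near: x; apply: cvgr0_norm_le => //; exact: divr_gt0.
Unshelve. all: end_near. Qed.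

End dot.

Section C1_calculus.
Context (R : realType) (k : nat).
Implicit Types (phi : 'cV[R]_k -> R) (q : 'cV[R]_k -> 'cV[R]_k).

(** Chain rule. The error is at most [C |D h|^2 / |h|], a product of the bounded quotient [D h / h]
    and of [D h], which tends to [0]. *)
Lemma C1_is_derive phi q (c : R -> 'cV[R]_k) (dc : 'cV[R]_k) (t : R) :
  C1 phi q -> (forall i, is_derive t 1 (fun s => c s i 0) (dc i 0)) ->
  is_derive t 1 (phi \o c) (dot (q (c t)) dc).
Proof.
move=> [C [r [r0 H]]] cP.
pose D (h : R) := c (h + t) - c t.
have Dh i : h^-1 * D h i 0 @[h --> 0^'] --> dc i 0.
  have [dci <-] := cP i.
  rewrite (_ : (fun h => h^-1 * D h i 0) = (fun h => h^-1 *: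
      (((fun s => c s i 0) \o shift t) (h *: (1 : R)) - c t i 0))); last first.
    by apply/funext => h; rewrite /D !mxE /GRing.scale/= mulr1.
  exact: dci.
have id0 : h @[h --> (0 : R)^'] --> (0 : R) by move=> A A0; exact: (nbhs_dnbhs A0).
(* [D h = h (D h / h)] fails to be usable at [h = 0], hence the detour through equality on a
   punctured neighbourhood. *)
have D0 i : D h i 0 @[h --> 0^'] --> 0.
  have H1 := cvgM id0 (Dh i); rewrite mul0r in H1.
  have : {near (0 : R)^', (fun h => h * (h^-1 * D h i 0)) =1 (fun h => D h i 0)}.
    near=> h; rewrite mulrA divff ?mul1r//.
    by near: h; exact: nbhs_dnbhs_neq.
  by move/near_eq_cvg/cvg_trans => A; apply: A; exact: H1.
have H0 : h^-1 * nsq (D h) @[h --> 0^'] --> 0.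
  rewrite -[X in _ --> X](_ : \sum_(i < k) (dc i 0 * 0) = 0); last first.
    by rewrite big1// => i _; rewrite mulr0.
  rewrite (_ : (fun h => h^-1 * nsq (D h)) =
      (fun h => \sum_i ((h^-1 * D h i 0) * D h i 0))); last first.
    by apply/funext => h; rewrite mulr_sumr; apply: eq_bigr => i _; rewrite mulrA.
  by apply: (@cvg_sumr _ _ _ (0^')) => i; exact: (cvgM (Dh i) (D0 i)).
have N0 : nsq (D h) @[h --> 0^'] --> 0.
  rewrite -[X in _ --> X](_ : \sum_(i < k) (0 * 0) = 0 :> R); last first.
    by rewrite big1// => i _; rewrite mulr0.
  by apply: (@cvg_sumr _ _ _ (0^')) => i; exact: (cvgM (D0 i) (D0 i)).
pose E h := h^-1 * (phi (c t + D h) - phi (c t) - dot (q (c t)) (D h)).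
have E0 : E h @[h --> 0^'] --> 0.
  apply: norm_cvg0.
  apply: (@squeeze_cvgr _ _ _ _ (fun=> 0) (fun h => C * `|h^-1 * nsq (D h)|)).
  - near=> h; rewrite normr_ge0/= /E normrM [in leRHS]normrM.
    rewrite mulrCA ler_wpM2l// (ger0_norm (nsq_ge0 _)) H//.
    by near: h; apply: (cvgr_le 0).
  - exact: cvg_cst.
  - have := cvgM (cvg_cst C) (cvg_norm H0); rewrite normr0 mulr0; exact.
have dotD : dot (q (c t)) (h^-1 *: D h) @[h --> 0^'] --> dot (q (c t)) dc.
  apply: (@cvg_sumr _ _ _ (0^')) => i; apply: cvgM; first exact: cvg_cst.
  by under eq_fun do rewrite mxE; exact: Dh.
have lim : h^-1 *: ((phi \o c) (h *: 1 + t) - (phi \o c) t) @[h --> 0^']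
     --> dot (q (c t)) dc.
  rewrite -[X in _ --> X]addr0.
  rewrite (_ : (fun h => _) = (fun h => dot (q (c t)) (h^-1 *: D h) + E h)).
    exact: cvgD.
  apply/funext => h; rewrite /E /D dotZr /= /GRing.scale/= mulr1.
  by rewrite [c t + _]addrC subrK -mulrDr [dot _ _ + _]addrC subrK.
apply: DeriveDef; first by apply/cvg_ex; exists (dot (q (c t)) dc).
exact/cvg_lim.
Unshelve. all: end_near. Qed.


Lemma C1_is_derive_line phi q x v (t : R) : C1 phi q ->
  is_derive t 1 (fun s => phi (x + s *: v)) (dot (q (x + t *: v)) v).
Proof.
move=> Hq; apply: (C1_is_derive (c := fun s => x + s *: v) Hq) => i.
rewrite (_ : (fun s => _) = (fun s => x i 0 + s * v i 0)); last first.
  by apply/funext => s; rewrite !mxE.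
by apply: is_derive_eq; rewrite add0r /GRing.scale/= ?mulr0 ?addr0 ?mulr1 ?add0r ?mul1r.
Qed.

(** Mean value theorem along the segment from [y] to [y + d]: the derivative of the remainder is a
    sum of terms [d_i] times the first-order error of [q_i], each of size [|d| |d|^2]. *)
Lemma C1_second_order phi q (h : 'I_k -> 'cV[R]_k -> 'cV[R]_k) :
  C1 phi q -> (forall i, C1 (fun y => q y i 0) (h i)) ->
  exists K r : R, 0 < r /\ forall y d, nsq d <= r ->
    `|phi (y + d) - phi y - dot (q y) d - 2^-1 * \sum_i d i 0 * dot (h i y) d|
      <= K * (nsq d * enorm d).
Proof.
move=> Hq /choice[C] /choice[r Hr].
have r0 i : 0 < r i by have [] := Hr i.
exists (\sum_i `|C i|), (\big[Num.min/1]_i r i); split.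
  by elim/big_ind: _ => // a b a0 b0; rewrite lt_min a0.
move=> y d dr.
have dri i : nsq d <= r i.
  by rewrite (le_trans dr)// (bigD1 i)//= ge_min lexx.
(* The Taylor remainder at [y + s d], up to the constant [phi y]; its increment over [[0, 1]] is the
   quantity to bound. *)
pose psi (s : R) := phi (y + s *: d) - s * dot (q y) d -
  s ^+ 2 * (2^-1 * \sum_i d i 0 * dot (h i y) d).
pose dpsi (s : R) := dot (q (y + s *: d)) d - dot (q y) d -
  s * \sum_i d i 0 * dot (h i y) d.
have psiP (s : R) : is_derive s (1 : R) psi (dpsi s).
  have := C1_is_derive_line y d s Hq => HL.
  rewrite /psi; apply: is_derive_eq.
  rewrite /dpsi /GRing.scale/=.
  by field.
have cpsi : {within `[0, 1], continuous psi}.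
  by apply: derivable_within_continuous => s _; have [] := psiP s.
have [s s01] := MVT ltr01 (fun s _ => psiP s) cpsi.
rewrite subr0 mulr1 /psi scale0r scale1r addr0 !mul0r expr0n/= !mul0r !subr0.
rewrite expr1n !mul1r => E.
rewrite [X in `|X|](_ : _ = dpsi s); last by rewrite -E; ring.
move: s01; rewrite in_itv/= => /andP[s0 s1].
have -> : dpsi s = \sum_i d i 0 *
    (q (y + s *: d) i 0 - q y i 0 - dot (h i y) (s *: d)).
  rewrite /dpsi /dot mulr_sumr -!sumrB; apply: eq_bigr => i _.
  rewrite -/(dot (h i y) d) -/(dot (h i y) (s *: d)) dotZr; ring.
apply: le_trans (ler_norm_sum _ _ _) _; rewrite mulr_suml ler_sum// => i _.
have [_ /(_ y (s *: d))] := Hr i.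
have nsd : nsq (s *: d) <= nsq d.
  by rewrite nsqZ ler_piMl ?nsq_ge0// exprn_ile1// ltW.
move=> /(_ (le_trans nsd (dri i))) Hi.
rewrite normrM mulrC mulrA ler_pM ?le_enorm//.
apply: le_trans Hi _; apply: le_trans (ler_wpM2r (nsq_ge0 _) (ler_norm _)) _.
by rewrite ler_wpM2l.
Qed.

End C1_calculus.

(** * Gaussian moments and convolutions *)

Section real_inequalities.
Context (R : realType).

(** [cosh t - 1 = 2 sinh(t / 2)^2] together with [sinh s >= s] for [s >= 0]; the latter holds
    because [e^x + e^-x - 2 = (e^x - 1)^2 / e^x] is nonnegative. *)
Lemma sqr_le_cosh (t : R) : 1 + t ^+ 2 / 2 <= (expR t + expR (- t)) / 2.
Proof.
wlog t0 : t / 0 <= t.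
  move=> H; have [/H//|/ltW t0] := leP 0 t.
  by have := H (- t); rewrite oppr_ge0 opprK sqrrN [expR (- t) + _]addrC; exact.
have sinh (s : R) : 0 <= s -> 2 * s <= expR s - expR (- s).
  rewrite le_eqVlt => /predU1P[<-|s0]; first by rewrite oppr0 subrr mulr0.
  pose f (x : R) := expR x - expR (- x) - 2 * x.
  pose df (x : R) := expR x + expR (- x) - 2.
  have fP (x : R) : is_derive x (1 : R) f (df x).
    by rewrite /f; apply: is_derive_eq; rewrite /df /GRing.scale/=; ring.
  have cf : {within `[0, s], continuous f}.
    by apply: derivable_within_continuous => x _; have [] := fP x.
  have [c _] := MVT s0 (fun x _ => fP x) cf.
  rewrite subr0 {1}/f {1}/f oppr0 subrr mulr0 subr0 !subr0 => E.
  rewrite -subr_ge0 E mulr_ge0 ?(ltW s0)// /df expRN.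
  have := expR_gt0 c; set a := expR c => a0.
  rewrite -(pmulr_rge0 _ a0) (_ : _ * _ = (a - 1) ^+ 2) ?sqr_ge0//.
  by field; rewrite gt_eqF.
have th0 : 0 <= t / 2 by rewrite divr_ge0.
have := sinh _ th0; rewrite mulrC divfK// => H.
have e1 : expR t = expR (t / 2) ^+ 2 by rewrite -expRM_natl; congr expR; field.
have e2 : expR (- t) = expR (- (t / 2)) ^+ 2.
  by rewrite -expRM_natl; congr expR; field.
have e3 : expR (t / 2) * expR (- (t / 2)) = 1 by rewrite -expRD subrr expR0.
rewrite e1 e2; move: H e3; set a := expR (t / 2); set b := expR _ => H e3.
have : t ^+ 2 <= (a - b) ^+ 2 by rewrite ler_sqr ?nnegrE// (le_trans t0).
by nra.
Qed.

(** Multiply by [e^-x >= 1 - x]: the product [(1 - x) (1 + x + 2 x^2) = 1 + x^2 (1 - 2 x)] is at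
    least [1] in this range. *)
Lemma expR_le_quadratic (x : R) : 0 <= x -> x <= 2^-1 ->
  expR x <= 1 + x + 2 * x ^+ 2.
Proof.
move=> x0 x1; have := expR_ge1Dx (- x); have := expR_gt0 (- x).
rewrite -[expR x]invrK -expRN; set a := expR (- x) => a0 ax.
rewrite -(ler_pM2l a0) divff ?gt_eqF//.
have : (1 + - x) * (1 + x + 2 * x ^+ 2) <= a * (1 + x + 2 * x ^+ 2).
  by rewrite ler_wpM2r// addr_ge0 ?addr_ge0// mulr_ge0// sqr_ge0.
apply: le_trans.
have -> : (1 + - x) * (1 + x + 2 * x ^+ 2) = 1 + x ^+ 2 * (1 - 2 * x) by ring.
by rewrite lerDl mulr_ge0 ?sqr_ge0// subr_ge0; lra.
Qed.

End real_inequalities.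

(** * Moments of [N] drawn from the translation formula *)

Section standard_gaussian.
Context d (T : measurableType d) (R : realType) (P : probability T R) (k : nat).
Variable N : T -> 'cV[R]_k.

(* The Cameron-Martin formula is the only property of the Gaussian law that is
   used from here on. *)
Definition gaussian_shift_law : Prop :=
  forall (v : 'cV[R]_k) (phi : 'cV[R]_k -> \bar R),
    (forall y, (0 <= phi y)%E) -> measurable_fun setT phi ->
    (\int[P]_w phi (N w + v)%R =
     \int[P]_w (phi (N w) * (expR (dot v (N w) - nsq v / 2))%:E))%E.

Hypothesis mN : measurable_fun setT N.
Hypothesis shiftN : gaussian_shift_law.

Local Notation E f := (Ex P f).
Local Notation itg f := (itg P f).
Local Notation wt v w := (expR (dot v (N w) - nsq v / 2)).

Lemma measurable_comp_N (phi : 'cV[R]_k -> R) :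
  measurable_fun setT phi -> measurable_fun setT (fun w => phi (N w)).
Proof. by move=> mphi; exact: measurableT_comp mphi mN. Qed.

Lemma measurable_dot (v : 'cV[R]_k) : measurable_fun setT (dot v).
Proof. by apply: continuous_mx_measurable; exact: continuous_dot. Qed.

Lemma measurable_nsq : measurable_fun setT (@nsq R k).
Proof. by apply: continuous_mx_measurable; exact: continuous_nsq. Qed.

Lemma measurable_dotN v : measurable_fun setT (fun w => dot v (N w)).
Proof. by apply: measurable_comp_N; exact: measurable_dot. Qed.

Lemma measurable_wt v : measurable_fun setT (fun w => wt v w).
Proof.
apply: measurableT_comp => //; apply: measurable_funB => /=.
  exact: measurable_dotN.
exact: measurable_cst.
Qed.

Lemma ge0_Ex_shift v (phi : 'cV[R]_k -> R) : measurable_fun setT phi ->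
  (forall y, 0 <= phi y) ->
  itg (fun w => phi (N w) * wt v w) ->
  itg (fun w => phi (N w + v)) /\
  E (fun w => phi (N w + v)) = E (fun w => phi (N w) * wt v w).
Proof.
move=> mphi phi0 Iw.
have mNv : measurable_fun setT (fun w => N w + v) by exact: measurable_cV_addr.
have H0 y : (0 <= (phi y)%:E)%E by rewrite lee_fin.
have H : (\int[P]_w (phi (N w + v))%:E = (E (fun w => phi (N w) * wt v w))%:E)%E.
  rewrite -Ex_EFin//.
  apply: etrans (shiftN v H0 _) _; first exact/measurable_EFinP.
  by apply: eq_integral => w _; rewrite EFinM.
split; last by rewrite /Ex /Rintegral H.
apply/integrableP; split.
  by apply/measurable_EFinP; exact: measurableT_comp mphi mNv.
under eq_integral do rewrite /= ger0_norm//.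
by rewrite H ltry.
Qed.

(** [gaussian_shift_law] speaks of nonnegative functions; apply it to [|phi|] and to [|phi| + phi],
    and subtract. *)
Lemma Ex_shift v (phi : 'cV[R]_k -> R) : measurable_fun setT phi ->
  itg (fun w => phi (N w) * wt v w) ->
  itg (fun w => phi (N w + v)) /\
  E (fun w => phi (N w + v)) = E (fun w => phi (N w) * wt v w).
Proof.
move=> mphi Iw.
have wt0 w : 0 <= wt v w by exact: expR_ge0.
have I1 : itg (fun w => `|phi (N w)| * wt v w).
  by apply: eq_itg (itg_norm Iw) => w; rewrite normrM (ger0_norm (wt0 w)).
have mabs : measurable_fun setT (fun y => `|phi y|) by exact: measurableT_comp.
have [I2 E2] := ge0_Ex_shift mabs (fun y => normr_ge0 _) I1.
have I3 : itg (fun w => (`|phi (N w)| + phi (N w)) * wt v w).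
  by apply: eq_itg (itgD I1 Iw) => w; rewrite mulrDl.
have [I4 E4] : itg (fun w => `|phi (N w + v)| + phi (N w + v)) /\
    E (fun w => `|phi (N w + v)| + phi (N w + v)) =
    E (fun w => (`|phi (N w)| + phi (N w)) * wt v w).
  apply: (ge0_Ex_shift (phi := fun y => `|phi y| + phi y)) => //.
    exact: measurable_funD.
  by move=> y; rewrite -lerBlDr sub0r -normrN ler_norm.
have I5 : itg (fun w => phi (N w + v)).
  by apply: eq_itg (itgB I4 I2) => w; rewrite addrAC subrr add0r.
split => //.
have E5 : E (fun w => (`|phi (N w)| + phi (N w)) * wt v w) =
    E (fun w => `|phi (N w)| * wt v w) + E (fun w => phi (N w) * wt v w).
  by rewrite -ExD//; apply: eq_Ex => w; rewrite mulrDl.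
by move: E4; rewrite ExD// E2 E5 => /addrI.
Qed.

(** The translation formula with [phi = 1] shows that the likelihood ratio has total mass [1]. *)
Lemma itg_wt v : itg (fun w => wt v w).
Proof.
apply/integrableP; split; first by apply/measurable_EFinP; exact: measurable_wt.
suff <- : (\int[P]_w 1 = \int[P]_w `|(wt v w)%:E|)%E.
  rewrite integral_cst// mul1e; apply: le_lt_trans (ltry 1).
  by apply: (@probability_le1 _ _ _ P).
apply: etrans (shiftN v (phi := fun=> 1%E) _ _) _ => [y|//|]; first exact: lee01.
by apply: eq_integral => w _; rewrite mul1e /= ger0_norm ?expR_ge0.
Qed.

Lemma Ex_wt v : E (fun w => wt v w) = 1.
Proof.
have [] := @Ex_shift v (fun=> 1) (measurable_cst _).
  by apply: eq_itg (itg_wt v) => w; rewrite mul1r.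
move=> _; rewrite Ex_cst => H; rewrite [RHS]H; apply: eq_Ex => w.
by rewrite mul1r.
Qed.

Lemma itg_expN v : itg (fun w => expR (dot v (N w))).
Proof.
apply: eq_itg (itgZ (expR (nsq v / 2)) (itg_wt v)) => w.
by rewrite -expRD; congr expR; ring.
Qed.

Lemma Ex_expN v : E (fun w => expR (dot v (N w))) = expR (nsq v / 2).
Proof.
transitivity (expR (nsq v / 2) * E (fun w => wt v w)); last by rewrite Ex_wt mulr1.
rewrite -ExZ; last exact: itg_wt.
by apply: eq_Ex => w; rewrite -expRD; congr expR; ring.
Qed.

Lemma itg_sqr_dotN v : itg (fun w => dot v (N w) ^+ 2).
Proof.
apply: (itg_le (itgD (itg_expN v) (itg_expN (- v)))).
  by apply: measurable_funX; exact: measurable_dotN.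
move=> w; rewrite ger0_norm ?sqr_ge0//.
have := sqr_le_cosh (dot v (N w)).
by rewrite dotNl; lra.
Qed.

Lemma itg_dotN v : itg (fun w => dot v (N w)).
Proof.
apply: (itg_le (itgD (itg_cst P 1) (itg_sqr_dotN v))).
  exact: measurable_dotN.
move=> w; have [x0|x0] := leP 0 (dot v (N w)).
  by rewrite ger0_norm//; nra.
by rewrite ltr0_norm//; nra.
Qed.

(* [1 + h E(v.N) <= E exp(h v.N) = exp(h^2 |v|^2 / 2)] for small [h] of both
   signs. *)
Lemma Ex_dotN v : E (fun w => dot v (N w)) = 0.
Proof.
have H (h : R) : h * E (fun w => dot v (N w)) <= expR (h ^+ 2 * (nsq v / 2)) - 1.
  rewrite lerBrDr addrC mulrA -nsqZ -Ex_expN -ExZ; last exact: itg_dotN.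
  rewrite -[X in X + _](Ex_cst P) -ExD; [|exact: itg_cst|exact/itgZ/itg_dotN].
  apply: Ex_le; [|exact: itg_expN|].
    by apply: itgD; [exact: itg_cst|exact/itgZ/itg_dotN].
  by move=> w; rewrite dotZl expR_ge1Dx.
set m := E _ in H *; set q := nsq v / 2 in H.
have q0 : 0 <= q by rewrite divr_ge0// nsq_ge0.
have {}H (h : R) : h ^+ 2 * q <= 2^-1 -> h * m <= 2 * (h ^+ 2 * q).
  move=> hq; apply: le_trans (H h) _.
  have h2q0 : 0 <= h ^+ 2 * q by rewrite mulr_ge0// sqr_ge0.
  have := expR_le_quadratic h2q0 hq.
  by nra.
apply/eqP; rewrite -normr_le0; apply/ler_addgt0Pr => e e0; rewrite add0r.
(* Small enough that [h^2 q <= 1/2], as [H] requires, and that [2 h q <= e], which bounds [m] and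
   [- m] after division by [h]. *)
pose h : R := Num.min 1 (Num.min 1 e / (2 * (q + 1))).
have h0 : 0 < h by rewrite lt_min ltr01 divr_gt0 ?lt_min ?ltr01 ?mulr_gt0//; lra.
have h1 : h <= 1 by rewrite ge_min lexx.
have hq : h * (2 * (q + 1)) <= Num.min 1 e.
  by rewrite -ler_pdivlMr ?ge_min ?lexx ?orbT// mulr_gt0//; lra.
move: hq; rewrite le_min => /andP[hq1 hqe].
have hh : h ^+ 2 * q <= 2^-1 by rewrite expr2; nra.
have H1 := H h hh; have := H (- h); rewrite sqrrN => /(_ hh) H2.
have {}H1 : m <= e by rewrite -(ler_pM2l h0); nra.
have {}H2 : - m <= e by rewrite -(ler_pM2l h0); nra.
by rewrite ler_norml H1 lerNl H2.
Qed.

(* Same argument with [cosh] in place of [exp]. *)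
Lemma Ex_sqr_dotN v : E (fun w => dot v (N w) ^+ 2) <= nsq v.
Proof.
set m := E _; set q := nsq v.
have q0 : 0 <= q by exact: nsq_ge0.
have H (h : R) : h ^+ 2 * q / 2 <= 2^-1 ->
    h ^+ 2 * m <= h ^+ 2 * q + h ^+ 2 * q * (h ^+ 2 * q).
  move=> hq.
  have h2q0 : 0 <= h ^+ 2 * q / 2 by rewrite divr_ge0// mulr_ge0// sqr_ge0.
  have := expR_le_quadratic h2q0 hq.
  have : 1 + (h ^+ 2 / 2) * m <= expR (h ^+ 2 * q / 2).
    rewrite -[X in X + _](Ex_cst P) -ExZ; last exact: itg_sqr_dotN.
    rewrite -ExD; [|exact: itg_cst|exact/itgZ/itg_sqr_dotN].
    have -> : expR (h ^+ 2 * q / 2) = E (fun w =>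
        2^-1 * (expR (dot (h *: v) (N w)) + expR (dot (- (h *: v)) (N w)))).
      rewrite ExZ; last by apply: itgD; exact: itg_expN.
      rewrite ExD; [|exact: itg_expN..].
      by rewrite !Ex_expN nsqN nsqZ; field.
    apply: Ex_le.
    - by apply: itgD; [exact: itg_cst|exact/itgZ/itg_sqr_dotN].
    - by apply/itgZ/itgD; exact: itg_expN.
    - move=> w; have := sqr_le_cosh (h * dot v (N w)).
      by rewrite dotNl dotZl; lra.
  by nra.
apply/ler_addgt0Pr => e e0.
(* [h2] stands for [h^2]. The denominator ensures [h2 q <= 1] and [h2 q^2 <= e]; dividing [H] by
   [h2] gives [m <= q + h2 q^2]. *)
pose h2 : R := Num.min 1 e / (q * q + q + 1).
have D0 : 0 < q * q + q + 1 by nra.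
have h20 : 0 < h2 by rewrite divr_gt0// lt_min ltr01.
have := H (Num.sqrt h2); rewrite sqr_sqrtr ?(ltW h20)//.
have : h2 * (q * q + q + 1) <= Num.min 1 e.
  by rewrite /h2 divfK ?gt_eqF.
rewrite le_min => /andP[h1 he] Hh.
have hq : h2 * q / 2 <= 2^-1 by nra.
have {}Hh := Hh hq.
rewrite -(ler_pM2l h20).
by nra.
Qed.

End standard_gaussian.

Section gaussian_smoothing.
Context d (T : measurableType d) (R : realType) (P : probability T R) (k : nat).
Variable N : T -> 'cV[R]_k.
Hypothesis mN : measurable_fun setT N.
Hypothesis shiftN : gaussian_shift_law P N.

Local Notation E f := (Ex P f).
Local Notation itg f := (itg P f).
Local Notation wt v w := (expR (dot v (N w) - nsq v / 2)).

Lemma itg_of_sqr (f : T -> R) : measurable_fun setT f -> itg (fun w => f w ^+ 2) -> itg f.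
Proof.
move=> mf If; apply: (itg_le (itgD (itg_cst P 1) If)) => // w.
rewrite -(real_normK (num_real (f w))).
by have := sqr_ge0 (`|f w| - 1); have := normr_ge0 (f w); nra.
Qed.

Lemma norm_mul_le_sqr (a b : R) : `|a * b| <= a ^+ 2 + b ^+ 2.
Proof.
rewrite normrM -(real_normK (num_real a)) -(real_normK (num_real b)).
by have := sqr_ge0 (`|a| - `|b|); have := normr_ge0 a; have := normr_ge0 b; nra.
Qed.

Lemma itgM_of_sqr (f g : T -> R) : measurable_fun setT f -> measurable_fun setT g ->
  itg (fun w => f w ^+ 2) -> itg (fun w => g w ^+ 2) ->
  itg (fun w => f w * g w).
Proof.
move=> mf mg If Ig; apply: (itg_le (itgD If Ig)).
  exact: measurable_funM.
by move=> w; exact: norm_mul_le_sqr.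
Qed.

Lemma measurable_affN (c : 'cV[R]_k) (s : R) :
  measurable_fun setT (fun w => c + s *: N w).
Proof.
apply: measurable_fun_mx => i j; under eq_fun do rewrite !mxE.
apply: measurable_funD => //; apply: measurable_funM => //.
exact: measurableT_comp (measurable_mx_entry i j) mN.
Qed.

Lemma coordNE i w : N w i 0 = dot (delta_mx i 0) (N w).
Proof. by rewrite dotC dot_delta. Qed.

Lemma itg_coordN i : itg (fun w => N w i 0).
Proof. by under eq_fun do rewrite coordNE; exact: itg_dotN. Qed.

Lemma itg_sqr_coordN i : itg (fun w => N w i 0 ^+ 2).
Proof. by under eq_fun do rewrite coordNE; exact: itg_sqr_dotN. Qed.

Lemma itg_nsqN : itg (fun w => nsq (N w)).
Proof. by under eq_fun do rewrite nsqE; apply: itg_sum => i; exact: itg_sqr_coordN. Qed.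

Lemma measurable_enorm : measurable_fun setT (@enorm R k).
Proof.
apply: measurableT_comp; first by apply: continuous_measurable_fun; exact: sqrt_continuous.
apply: measurable_sum => i; apply: measurable_funX; exact: measurable_mx_entry.
Qed.

Lemma itg_enormN : itg (fun w => enorm (N w)).
Proof.
apply: (itg_le (itgD (itg_cst P 1) itg_nsqN)).
  exact: measurableT_comp measurable_enorm mN.
by move=> w; rewrite ger0_norm ?enorm_ge0// enorm_le_nsq.
Qed.

(** A class containing both kinds of functions to be convolved: Lipschitz ones ([growth_lip1]) and
    bounded ones ([growth_bounded]), the latter for the components of gradients. The bound is
    uniform in the base point [y]. *)
Definition growth (L : R) (phi : 'cV[R]_k -> R) :=
  forall y z, (phi (y + z) - phi y) ^+ 2 <= L * (1 + nsq z).


Lemma growth_bounded (B : R) phi : (forall y, `|phi y| <= B) -> growth (4 * B ^+ 2) phi.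
Proof.
move=> phiB y z.
have B0 : 0 <= B by rewrite (le_trans _ (phiB 0)).
apply: (@le_trans _ _ (4 * B ^+ 2)); last first.
  by rewrite ler_peMr ?mulr_ge0 ?sqr_ge0// lerDl nsq_ge0.
rewrite -real_normK ?num_real// (_ : 4 * B ^+ 2 = (2 * B) ^+ 2); last by ring.
rewrite ler_sqr ?nnegrE ?mulr_ge0//.
by rewrite (le_trans (ler_normB _ _))// mulr_natl mulr2n lerD.
Qed.

Definition lip1 (phi : 'cV[R]_k -> R) := forall x y, `|phi x - phi y| <= enorm (x - y).

Lemma growth_lip1 phi : lip1 phi -> growth 1 phi.
Proof.
move=> phiL y z; rewrite -real_normK ?num_real// mul1r.
apply: (@le_trans _ _ (nsq z)); last by rewrite lerDr.
rewrite -sqr_enorm ler_sqr ?nnegrE ?enorm_ge0//.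
by have := phiL (y + z) y; rewrite addrAC subrr add0r.
Qed.

Lemma lip1_continuous phi : lip1 phi -> continuous phi.
Proof.
move=> phiL y; apply/(@cvgrPdist_le _ _ _ (nbhs y)) => e e0.
have S0 : \sum_(i < k) `|y i 0 - x i 0| @[x --> y] --> 0.
  rewrite -[X in _ --> X](_ : \sum_(i < k) `|y i 0 - y i 0| = 0); last first.
    by rewrite big1// => i _; rewrite subrr normr0.
  apply: (@cvg_sumr _ _ _ (nbhs y)) => i.
  apply: (@cvg_norm _ _ _ (nbhs y)); apply: (@cvgB _ _ _ (nbhs y)).
    exact: cvg_cst.
  exact: coord_continuous.
near=> x; apply: le_trans (phiL _ _) _; apply: le_trans (enorm_le_sum _) _.
rewrite (eq_bigr (fun i => `|y i 0 - x i 0|)); last by move=> i _; rewrite !mxE.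
by near: x; exact: (cvgr_le 0).
Unshelve. all: end_near. Qed.

Lemma lip1_measurable (phi : 'cV[R]_k -> R) : lip1 phi -> measurable_fun setT phi.
Proof. by move=> H; apply: continuous_mx_measurable; exact: lip1_continuous. Qed.

Lemma C1_measurable (phi : 'cV[R]_k -> R) q : C1 phi q -> measurable_fun setT phi.
Proof. by move=> H; apply: continuous_mx_measurable; exact: C1_continuous H. Qed.

(** A pointwise limit of difference quotients, each of them measurable. *)
Lemma C1_measurable_dir (phi : 'cV[R]_k -> R) q v : C1 phi q ->
  measurable_fun setT (fun y => dot (q y) v).
Proof.
move=> phiq; have mphi := C1_measurable phiq.
apply: (@measurable_fun_cvg _ 'cV[R]_k R setT (fun n y =>
  n.+1%:R * (phi (y + n.+1%:R^-1 *: v) - phi y))).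
  move=> n; apply: measurable_funM => //; apply: measurable_funB => //.
  apply: measurableT_comp mphi _; apply: measurable_cV_addr; exact: measurable_id.
by move=> y _; exact: C1_cvg_dir.
Qed.

Lemma C1_measurable_grad (phi : 'cV[R]_k -> R) q i : C1 phi q ->
  measurable_fun setT (fun y => q y i 0).
Proof.
by move=> /(C1_measurable_dir (delta_mx i 0)); under eq_fun do rewrite dot_delta.
Qed.

(** The bound [|grad phi| <= 1] in dual form, ready to be applied to random directions [v]. *)
Lemma C1_lip1_dot phi q : lip1 phi -> C1 phi q ->
  forall y v, `|dot (q y) v| <= enorm v.
Proof.
move=> phiL phiq y v.
have H : `|n.+1%:R * (phi (y + n.+1%:R^-1 *: v) - phi y)| @[n --> \oo] -->
    `|dot (q y) v| by apply: cvg_norm; exact: C1_cvg_dir.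
apply: (cvgr_to_le H); apply: nearW => n.
rewrite normrM ger0_norm// -ler_pdivlMl ?ltr0n//.
apply: le_trans (phiL _ _) _.
by rewrite addrAC subrr add0r enormZ ger0_norm// invr_ge0.
Qed.

(** The second-moment bound does not depend on the centre [c]; the uniform constants of the
    convolution lemmas come from it. *)
Lemma itg_growth L (phi : 'cV[R]_k -> R) c s : measurable_fun setT phi -> growth L phi ->
  [/\ itg (fun w => phi (c + s *: N w) - phi c),
      itg (fun w => (phi (c + s *: N w) - phi c) ^+ 2),
      itg (fun w => phi (c + s *: N w)) &
      E (fun w => (phi (c + s *: N w) - phi c) ^+ 2) <=
        L * (1 + s ^+ 2 * E (fun w => nsq (N w)))].
Proof.
move=> mphi phiL.
have m1 : measurable_fun setT (fun w => phi (c + s *: N w)).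
  exact: measurableT_comp mphi (measurable_affN c s).
have m2 : measurable_fun setT (fun w => phi (c + s *: N w) - phi c).
  exact: measurable_funB.
have I0 : itg (fun w => L * (1 + s ^+ 2 * nsq (N w))).
  by apply/itgZ/itgD; [exact: itg_cst|exact/itgZ/itg_nsqN].
have le2 w : (phi (c + s *: N w) - phi c) ^+ 2 <= L * (1 + s ^+ 2 * nsq (N w)).
  by rewrite -nsqZ; exact: phiL.
have I2 : itg (fun w => (phi (c + s *: N w) - phi c) ^+ 2).
  apply: (itg_le I0); first exact: measurable_funX.
  by move=> w; rewrite ger0_norm ?sqr_ge0.
have I1 := itg_of_sqr m2 I2.
split => //.
  by apply: eq_itg (itgD I1 (itg_cst P (phi c))) => w; rewrite subrK.
apply: le_trans (Ex_le I2 I0 le2) _.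
rewrite ExZ; last by apply/itgD; [exact: itg_cst|exact/itgZ/itg_nsqN].
by rewrite ExD ?Ex_cst ?ExZ//; [exact: itg_nsqN|exact: itg_cst|exact/itgZ/itg_nsqN].
Qed.

(* Second moment of the Taylor remainder of the likelihood ratio; it is
   computed exactly from [wt v ^+ 2 = expR (nsq v) * wt (2 v)]. *)
Lemma Ex_sqr_wt_rem v : nsq v <= 2^-1 ->
  itg (fun w => (wt v w - 1 - dot v (N w)) ^+ 2) /\
  E (fun w => (wt v w - 1 - dot v (N w)) ^+ 2) <= 2 * nsq v ^+ 2.
Proof.
move=> v2.
have mX := measurable_dotN mN v; have mw := measurable_wt mN v.
have wt2E w : wt v w ^+ 2 = expR (nsq v) * wt (2 *: v) w.
  rewrite -expRM_natl -expRD; congr expR.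
  by rewrite dotZl nsqZ; field.
have Iw2 : itg (fun w => wt v w ^+ 2).
  by under eq_fun do rewrite wt2E; apply/itgZ/itg_wt.
have Ew2 : E (fun w => wt v w ^+ 2) = expR (nsq v).
  by under eq_Ex do rewrite wt2E; rewrite ExZ ?Ex_wt ?mulr1//; exact: itg_wt.
have IX := itg_dotN mN shiftN v; have IX2 := itg_sqr_dotN mN shiftN v.
have Iw := itg_wt mN shiftN v.
have IXw : itg (fun w => dot v (N w) * wt v w) by exact: itgM_of_sqr.
(* Under the weight [wt v], [N] is distributed as [N + v], so this is the mean of
   [v . N + |v|^2]. *)
have EXw : E (fun w => dot v (N w) * wt v w) = nsq v.
  have [_ <-] := Ex_shift mN shiftN (measurable_dot v) IXw.
  under eq_Ex do rewrite dotDr.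
  rewrite ExD; [|exact: IX|exact: itg_cst].
  by rewrite Ex_dotN// Ex_cst add0r.
pose rhs w := wt v w ^+ 2 + 1 + dot v (N w) ^+ 2 - 2 * wt v w
   - 2 * (dot v (N w) * wt v w) + 2 * dot v (N w).
have rE w : (wt v w - 1 - dot v (N w)) ^+ 2 = rhs w by rewrite /rhs; ring.
have I1 : itg (fun w => wt v w ^+ 2 + 1) by apply: itgD => //; exact: itg_cst.
have I2 := itgD I1 IX2.
have I3 := itgB I2 (itgZ 2 Iw).
have I4 := itgB I3 (itgZ 2 IXw).
have I5 := itgD I4 (itgZ 2 IX).
rewrite (funext rE).
split => //; rewrite /rhs.
rewrite ExD//; last exact: itgZ.
rewrite ExB//; last exact: itgZ.
rewrite ExB//; last exact: itgZ.
rewrite ExD// ExD//; last exact: itg_cst.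
rewrite !ExZ// Ex_cst Ew2 Ex_wt// EXw Ex_dotN//.
(* With [q = |v|^2], the sum is at most [e^q + 1 + q - 2 - 2 q = e^q - 1 - q], hence at most
   [2 q^2]. *)
have := Ex_sqr_dotN mN shiftN v.
have := expR_le_quadratic (nsq_ge0 v) v2.
by lra.
Qed.

End gaussian_smoothing.

Section gaussian_convolution.
Context d (T : measurableType d) (R : realType) (P : probability T R) (k : nat).
Variable N : T -> 'cV[R]_k.
Hypothesis mN : measurable_fun setT N.
Hypothesis shiftN : gaussian_shift_law P N.

Local Notation E f := (Ex P f).
Local Notation itg f := (itg P f).
Local Notation wt v w := (expR (dot v (N w) - nsq v / 2)).

(** Two scalars, so that one operator covers the smoothing ([a = 1]) and the interpolation
    ([a = cos t], [s = sigma sin t]). *)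
Definition avg (a s : R) (phi : 'cV[R]_k -> R) (x : 'cV[R]_k) : R :=
  E (fun w => phi (a *: x + s *: N w)).

Lemma measurable_coordN i : measurable_fun setT (fun w => N w i 0).
Proof. exact: measurableT_comp (measurable_mx_entry i 0) mN. Qed.

Lemma itg_growthM L phi c s i : measurable_fun setT phi -> growth L phi ->
  itg (fun w => (phi (c + s *: N w) - phi c) * N w i 0).
Proof.
move=> mphi phiL; have [I1 I2 _ _] := itg_growth mN shiftN c s mphi phiL.
apply: itgM_of_sqr => //; first exact: itg_measurable I1.
  exact: measurable_coordN.
exact: itg_sqr_coordN.
Qed.

(* The increment of [avg 1 s phi] is the expectation of [phi] against the increment
   of the likelihood ratio [wt]; AM-GM and the second moment of the Taylor remainder
   of [wt] bound the error. *)
Lemma C1_avg1 s phi L : 0 < s -> measurable_fun setT phi -> growth L phi ->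
  C1 (avg 1 s phi) (fun y => \col_i
    (s^-1 * E (fun w => (phi (y + s *: N w) - phi y) * N w i 0))).
Proof.
move=> s0 mphi phiL; have sn0 : s != 0 by rewrite gt_eqF.
pose K := L * (1 + s ^+ 2 * E (fun w => nsq (N w))).
have s20 : 0 < s ^+ 2 by rewrite exprn_gt0.
(* The radius makes [|dl / s|^2 <= 1/2], the range of [Ex_sqr_wt_rem]; [K] bounds the second moment
   of the increment [psi (N w)]. *)
exists ((K / 2 + 1) / s ^+ 2), (s ^+ 2 / 2); split; first by rewrite divr_gt0.
move=> y dl hd.
(* Set apart because the AM-GM weight below divides by [nsq v]. *)
have [->|dl0] := eqVneq dl 0.
  by rewrite addr0 subrr dot0r subr0 normr0 nsq0 mulr0.
pose v := s^-1 *: dl.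
have vE : nsq dl = s ^+ 2 * nsq v by rewrite /v nsqZ mulrA -exprMn divff// expr1n mul1r.
have v2 : nsq v <= 2^-1 by move: hd; rewrite vE ler_pM2l.
have v0 : 0 < nsq v.
  by rewrite lt_neqAle nsq_ge0 andbT eq_sym nsq_eq0 scaler_eq0 invr_eq0 negb_or sn0.
pose psi z := phi (y + s *: z) - phi y.
have mpsi : measurable_fun setT psi.
  apply: measurable_funB => //; apply: measurableT_comp mphi _.
  apply: measurable_fun_mx => i j; under eq_fun do rewrite !mxE.
  apply: measurable_funD => //; apply: measurable_funM => //.
  exact: measurable_mx_entry.
have [Ipsi Ipsi2 Iphi Epsi2] := itg_growth mN shiftN y s mphi phiL.
have mpsiN : measurable_fun setT (fun w => psi (N w)) by exact: itg_measurable Ipsi.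
have [Ir Er] := Ex_sqr_wt_rem mN shiftN v2.
have mX := measurable_dotN mN v; have mw := measurable_wt mN v.
have Iw := itg_wt mN shiftN v.
have IX := itg_dotN mN shiftN v.
have IpX : itg (fun w => psi (N w) * dot v (N w)).
  by apply: itgM_of_sqr => //; exact: itg_sqr_dotN.
have mr : measurable_fun setT (fun w => wt v w - 1 - dot v (N w)).
  by apply: measurable_funB => //; exact: measurable_funB.
have Ipr : itg (fun w => psi (N w) * (wt v w - 1 - dot v (N w))).
  exact: itgM_of_sqr.
have Ipw : itg (fun w => psi (N w) * wt v w).
  apply: eq_itg (itgD (itgD Ipr Ipsi) IpX) => w.
  by rewrite -/(psi (N w)); ring.
have [Is Es] := Ex_shift mN shiftN mpsi Ipw.
have E1 : avg 1 s phi (y + dl) = phi y + E (fun w => psi (N w) * wt v w).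
  rewrite -Es -[phi y](Ex_cst P) -ExD//; last exact: itg_cst.
  apply: eq_Ex => w; rewrite [RHS]addrC /psi subrK scale1r; congr (phi _).
  by rewrite scalerDr /v scalerA divff// scale1r -addrA [dl + _]addrC.
have E0 : avg 1 s phi y = phi y + E (fun w => psi (N w)).
  rewrite -[phi y](Ex_cst P) -ExD//; last exact: itg_cst.
  by apply: eq_Ex => w; rewrite [RHS]addrC /psi subrK scale1r.
have Ed : dot (\col_i (s^-1 * E (fun w => psi (N w) * N w i 0))) dl =
    E (fun w => psi (N w) * dot v (N w)).
  transitivity (E (fun w => \sum_i v i 0 * (psi (N w) * N w i 0))).
    rewrite Ex_sum; last by move=> i; apply: itgZ; exact: (itg_growthM _ _ _ mphi phiL).
    apply: eq_bigr => i _; rewrite ExZ; last exact: (itg_growthM _ _ _ mphi phiL).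
    by rewrite !mxE; ring.
  apply: eq_Ex => w; rewrite /dot mulr_sumr; apply: eq_bigr => i _; ring.
have -> : avg 1 s phi (y + dl) - avg 1 s phi y -
    dot (\col_i (s^-1 * E (fun w => psi (N w) * N w i 0))) dl =
    E (fun w => psi (N w) * (wt v w - 1 - dot v (N w))).
  rewrite E1 E0 Ed.
  have -> : E (fun w => psi (N w) * wt v w) =
     E (fun w => psi (N w) * (wt v w - 1 - dot v (N w))) + E (fun w => psi (N w))
     + E (fun w => psi (N w) * dot v (N w)).
    rewrite -ExD// -ExD//; last exact: itgD.
    by apply: eq_Ex => w; ring.
  by ring.
(* AM-GM weighted by [|v|^2]: the remainder of [wt] has second moment of order [|v|^4], so both
   terms become of order [|v|^2]. *)
pose bnd w := 2^-1 * (nsq v * psi (N w) ^+ 2 +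
   (nsq v)^-1 * (wt v w - 1 - dot v (N w)) ^+ 2).
have Ib1 : itg (fun w => nsq v * psi (N w) ^+ 2) by exact: itgZ.
have Ib2 : itg (fun w => (nsq v)^-1 * (wt v w - 1 - dot v (N w)) ^+ 2).
  exact: itgZ.
have Ib : itg bnd by apply/itgZ/itgD.
apply: (le_trans (Ex_norm_le Ib _ _)).
- exact: itg_measurable Ipr.
- move=> w; rewrite /bnd; set p := psi _; set x := _ - _ - _; set q := nsq v.
  have -> : 2^-1 * (q * p ^+ 2 + q^-1 * x ^+ 2) =
     q^-1 * (2^-1 * ((q * p) ^+ 2 + x ^+ 2)).
    by field; rewrite gt_eqF.
  rewrite ler_pdivlMl// -[X in X * _](ger0_norm (ltW v0)) -normrM.
  rewrite mulrA normrM -(real_normK (num_real (q * p))) -(real_normK (num_real x)).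
  by have := sqr_ge0 (`|q * p| - `|x|); nra.
- rewrite ExZ; last exact: itgD.
  rewrite ExD// ExZ// ExZ//.
  have -> : (K / 2 + 1) / s ^+ 2 * nsq dl =
      2^-1 * (nsq v * K + (nsq v)^-1 * (2 * nsq v ^+ 2)).
    by rewrite vE; field; rewrite !gt_eqF.
  by rewrite ler_pM2l// lerD// ler_pM2l// invr_gt0.
Qed.

(** Centring at [phi y] makes the bound uniform in [y], even for unbounded [phi]; the final [+ 1]
    bounds the second moment of a coordinate of [N]. *)
Lemma avg1_grad_bounded s phi L : 0 < s -> measurable_fun setT phi -> growth L phi ->
  exists B, forall y i,
    `|s^-1 * E (fun w => (phi (y + s *: N w) - phi y) * N w i 0)| <= B.
Proof.
move=> s0 mphi phiL.
exists (s^-1 * (L * (1 + s ^+ 2 * E (fun w => nsq (N w))) + 1)) => y i.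
have [I1 I2 _ E2] := itg_growth mN shiftN y s mphi phiL.
rewrite normrM ger0_norm ?invr_ge0 ?(ltW s0)// ler_wpM2l ?invr_ge0 ?(ltW s0)//.
have IN2 := itg_sqr_coordN mN shiftN i.
apply: le_trans (Ex_norm_le (itgD I2 IN2) _ _) _.
- by apply: itg_measurable; exact: itg_growthM.
- by move=> w; exact: norm_mul_le_sqr.
- rewrite ExD// lerD//.
  under eq_Ex do rewrite coordNE.
  by rewrite (le_trans (Ex_sqr_dotN mN shiftN _))// nsq_delta.
Qed.

(** The first-order error of [phi] is uniform, so it can be integrated as it stands. Dividing the
    radius by [a^2 + 1] keeps [a dl] within the range of [phi], also when [a = 0]. *)
Lemma C1_avg a s phi q L B : C1 phi q -> growth L phi ->
  (forall y i, `|q y i 0| <= B) ->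
  C1 (avg a s phi) (fun x => \col_i (a * avg a s (fun y => q y i 0) x)).
Proof.
move=> phiq phiL qB; have mphi := C1_measurable phiq.
have [C [r [r0 H]]] := phiq.
have a20 : 0 < a ^+ 2 + 1 by rewrite ltr_wpDl// sqr_ge0.
exists (`|C| * a ^+ 2), (r / (a ^+ 2 + 1)); split; first by rewrite divr_gt0.
move=> x dl; rewrite ler_pdivlMr// => hd.
have adl : nsq (a *: dl) <= r.
  by rewrite nsqZ; apply: le_trans hd; have := nsq_ge0 dl; nra.
have [_ _ I1 _] := itg_growth mN shiftN (a *: (x + dl)) s mphi phiL.
have [_ _ I0 _] := itg_growth mN shiftN (a *: x) s mphi phiL.
have mq i : measurable_fun setT (fun w => q (a *: x + s *: N w) i 0).
  apply: (measurableT_comp (C1_measurable_grad i phiq)).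
  exact: measurable_affN.
have Iq i : itg (fun w => q (a *: x + s *: N w) i 0).
  by apply: itg_bounded => // w; exact: qB.
have Id : itg (fun w => dot (q (a *: x + s *: N w)) (a *: dl)).
  apply: itg_sum => i; apply: eq_itg (itgZ ((a *: dl) i 0) (Iq i)) => w.
  by rewrite mulrC.
have -> : dot (\col_i (a * avg a s (fun y => q y i 0) x)) dl =
    E (fun w => dot (q (a *: x + s *: N w)) (a *: dl)).
  rewrite Ex_sum; last first.
    by move=> i; apply: eq_itg (itgZ ((a *: dl) i 0) (Iq i)) => w; rewrite mulrC.
  apply: eq_bigr => i _.
  transitivity (E (fun w => (a *: dl) i 0 * q (a *: x + s *: N w) i 0)).
    by rewrite ExZ// !mxE /avg; ring.
  by apply: eq_Ex => w; rewrite mulrC.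
rewrite /avg -ExB// -ExB//; last exact: itgB.
apply: le_trans (Ex_norm_le (itg_cst P (`|C| * nsq (a *: dl))) _ _) _.
- exact: itg_measurable (itgB (itgB I1 I0) Id).
- move=> w; have -> : a *: (x + dl) + s *: N w = a *: x + s *: N w + a *: dl.
    by rewrite scalerDr addrAC.
  apply: le_trans (H _ _ adl) _.
  by rewrite ler_wpM2r ?nsq_ge0// ler_norm.
- by rewrite Ex_cst nsqZ mulrA.
Qed.

(* Both sides are the gradient of [avg 1 s phi]: one differentiates [phi], the
   other the Gaussian weight. *)
Lemma gaussian_ibp s phi q L B c i : 0 < s -> C1 phi q -> growth L phi ->
  (forall y i, `|q y i 0| <= B) ->
  E (fun w => q (c + s *: N w) i 0) =
    s^-1 * E (fun w => phi (c + s *: N w) * N w i 0).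
Proof.
move=> s0 phiq phiL qB; have mphi := C1_measurable phiq.
have := C1_unique (C1_avg 1 s phiq phiL qB) (C1_avg1 s0 mphi phiL).
move=> /(congr1 (fun f : 'cV[R]_k -> 'cV[R]_k => f c i 0)); rewrite !mxE mul1r /avg scale1r => ->.
have IM := itg_growthM c s i mphi phiL.
have IN := itg_coordN mN shiftN i.
(* Removing the centring at [phi c] costs nothing, since the coordinates of [N] have mean zero. *)
have -> : (fun w => phi (c + s *: N w) * N w i 0) =
   (fun w => (phi (c + s *: N w) - phi c) * N w i 0 + phi c * N w i 0).
  by apply/funext => w; ring.
rewrite ExD//; last exact: itgZ.
rewrite ExZ// (_ : E (fun w => N w i 0) = 0) ?mulr0 ?addr0//.
by under eq_Ex do rewrite coordNE; exact: Ex_dotN.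
Qed.

Lemma avg_lipschitz a s phi x y : lip1 phi ->
  `|avg a s phi x - avg a s phi y| <= `|a| * enorm (x - y).
Proof.
move=> phiL; have mphi := lip1_measurable phiL.
have [_ _ Ix _] := itg_growth mN shiftN (a *: x) s mphi (growth_lip1 phiL).
have [_ _ Iy _] := itg_growth mN shiftN (a *: y) s mphi (growth_lip1 phiL).
rewrite /avg -ExB//.
apply: le_trans (Ex_norm_le (itg_cst P (`|a| * enorm (x - y))) _ _) _.
- exact: itg_measurable (itgB Ix Iy).
- move=> w; apply: le_trans (phiL _ _) _.
  by rewrite opprD addrACA subrr addr0 -scalerBr enormZ.
- by rewrite Ex_cst.
Qed.

Lemma avg1_lip1 s phi : lip1 phi -> lip1 (avg 1 s phi).
Proof. by move=> H x y; have := avg_lipschitz 1 s x y H; rewrite normr1 mul1r. Qed.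

Lemma avg1_close s phi y : 0 <= s -> lip1 phi ->
  `|avg 1 s phi y - phi y| <= s * E (fun w => enorm (N w)).
Proof.
move=> s0 phiL; have mphi := lip1_measurable phiL.
have [I1 _ I0 _] := itg_growth mN shiftN y s mphi (growth_lip1 phiL).
rewrite /avg scale1r -[phi y in X in `|X|](Ex_cst P) -ExB//; last exact: itg_cst.
have IN := itg_enormN mN shiftN.
rewrite -ExZ//; apply: Ex_norm_le; [exact: itgZ|exact: itg_measurable I1|].
move=> w; apply: le_trans (phiL _ _) _.
by rewrite addrAC subrr add0r enormZ ger0_norm.
Qed.

(* A first convolution has a bounded, merely measurable gradient; a second one
   makes this gradient differentiable. *)
Lemma lipschitz_C2_approx g e : lip1 g -> 0 < e ->
  exists (h : 'cV[R]_k -> R) (p : 'cV[R]_k -> 'cV[R]_k)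
         (Q : 'I_k -> 'cV[R]_k -> 'cV[R]_k) (B : R),
    [/\ lip1 h, C1 h p, (forall i, C1 (fun y => p y i 0) (Q i)),
        (forall i y j, `|Q i y j 0| <= B) & (forall y, `|h y - g y| <= e)].
Proof.
move=> gL e0.
pose m := E (fun w => enorm (N w)).
have m0 : 0 <= m by apply: Ex_ge0 => w; exact: enorm_ge0.
(* Each of the two convolutions moves the function by at most [t m], and [2 t m <= e]. *)
pose t := e / (2 * (m + 1)).
have t0 : 0 < t by rewrite divr_gt0// mulr_gt0// ltr_wpDl.
pose g1 := avg 1 t g; pose h := avg 1 t g1.
have mg := lip1_measurable gL.
have g1L : lip1 g1 by exact: avg1_lip1.
have hL : lip1 h by exact: avg1_lip1.
have g1q := C1_avg1 t0 mg (growth_lip1 gL).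
set q := (fun y => \col_i _) in g1q.
have qB y i : `|q y i 0| <= 1.
  by rewrite -dot_delta -(enorm_delta R i); exact: C1_lip1_dot g1L g1q _ _.
have hp := C1_avg 1 t g1q (growth_lip1 g1L) qB.
set p := (fun y => \col_i _) in hp.
have mq i := C1_measurable_grad i g1q.
have qG i := growth_bounded (fun y => qB y i).
pose Q i y := \col_j (t^-1 * E (fun w => (q (y + t *: N w) i 0 - q y i 0) * N w j 0)).
have pQ i : C1 (fun y => p y i 0) (Q i).
  rewrite (_ : (fun y => p y i 0) = avg 1 t (fun y => q y i 0)).
    exact: C1_avg1 (mq i) (qG i).
  by apply/funext => y; rewrite mxE mul1r.
have /choice[B HB] : forall i, exists B, forall y j, `|Q i y j 0| <= B.
  move=> i; have [B HB] := avg1_grad_bounded t0 (mq i) (qG i).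
  by exists B => y j; rewrite mxE.
exists h, p, Q, (\sum_i `|B i|); split => //.
  move=> i y j; apply: le_trans (HB i y j) _; apply: le_trans (ler_norm _) _.
  by rewrite (bigD1 i)//= lerDl sumr_ge0.
move=> y.
apply: le_trans (ler_distD (g1 y) _ _) _.
apply: le_trans (lerD (avg1_close y (ltW t0) g1L) (avg1_close y (ltW t0) gL)) _.
have tE : t * (2 * (m + 1)) = e.
  by rewrite divfK// gt_eqF// mulr_gt0// ltr_wpDl.
by rewrite -/m; nra.
Qed.

End gaussian_convolution.

Lemma sqr_hs_norm (R : realType) k (M : 'M[R]_k) :
  hs_norm M ^+ 2 = \sum_i \sum_j M i j ^+ 2.
Proof.
have trE : \tr (M *m M^T) = \sum_i \sum_j M i j ^+ 2.
  apply: eq_bigr => i _; rewrite mxE; apply: eq_bigr => j _.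
  by rewrite mxE expr2.
rewrite /hs_norm sqr_sqrtr trE// sumr_ge0// => i _; rewrite sumr_ge0// => j _.
exact: sqr_ge0.
Qed.

Lemma hs_norm_ge0 (R : realType) k (M : 'M[R]_k) : 0 <= hs_norm M.
Proof. exact: sqrtr_ge0. Qed.

(** * The smoothing-independent bound on the averaged Hessian *)

Section hessian_bound.
Context d (T : measurableType d) (R : realType) (P : probability T R) (k : nat).
Variable N : T -> 'cV[R]_k.
Hypothesis mN : measurable_fun setT N.
Hypothesis shiftN : gaussian_shift_law P N.

Local Notation E f := (Ex P f).
Local Notation itg f := (itg P f).

Lemma mulmx_rowE (M : 'M[R]_k) (x : 'cV[R]_k) i :
  (M *m x) i 0 = dot (row i M)^T x.
Proof. by rewrite mxE; apply: eq_bigr => j _; rewrite !mxE. Qed.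

Lemma itg_nsq_mulN (M : 'M[R]_k) : itg (fun w => nsq (M *m N w)).
Proof.
under eq_fun do rewrite nsqE.
apply: itg_sum => i; under eq_fun do rewrite mulmx_rowE.
exact: itg_sqr_dotN.
Qed.

Lemma Ex_nsq_mulN (M : 'M[R]_k) : E (fun w => nsq (M *m N w)) <= hs_norm M ^+ 2.
Proof.
under eq_Ex do rewrite nsqE.
rewrite Ex_sum; last first.
  by move=> i; under eq_fun do rewrite mulmx_rowE; exact: itg_sqr_dotN.
rewrite sqr_hs_norm ler_sum// => i _; under eq_Ex do rewrite mulmx_rowE.
apply: le_trans (Ex_sqr_dotN mN shiftN _) _.
by rewrite nsqE ler_sum// => j _; rewrite !mxE.
Qed.

Lemma measurable_mulN (M : 'M[R]_k) : measurable_fun setT (fun w => M *m N w).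
Proof.
apply: measurable_fun_mx => i j; rewrite ord1.
under eq_fun do rewrite mulmx_rowE; exact: measurable_dotN.
Qed.

Lemma itg_enorm_mulN (M : 'M[R]_k) : itg (fun w => enorm (M *m N w)).
Proof.
apply: (itg_le (itgD (itg_cst P 1) (itg_nsq_mulN M))).
  exact: measurableT_comp (@measurable_enorm R k) (measurable_mulN M).
by move=> w; rewrite ger0_norm ?enorm_ge0// enorm_le_nsq.
Qed.

(** The square root of the second moment, reached through [x <= (c + x^2 / c) / 2] with
    [c = hs_norm M + e]; the slack [e] keeps [c] positive when [M] vanishes. *)
Lemma Ex_enorm_mulN (M : 'M[R]_k) : E (fun w => enorm (M *m N w)) <= hs_norm M.
Proof.
apply/ler_addgt0Pr => e e0.
set m := hs_norm M; have m0 : 0 <= m by exact: hs_norm_ge0.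
pose c := m + e; have c0 : 0 < c by rewrite ltr_wpDl.
have I2 := itg_nsq_mulN M.
have Ib : itg (fun w => 2^-1 * (c + c^-1 * nsq (M *m N w))).
  by apply/itgZ/itgD; [exact: itg_cst|exact: itgZ].
apply: le_trans (Ex_le (itg_enorm_mulN M) Ib _) _.
  move=> w; rewrite -sqr_enorm; set x := enorm _.
  have -> : 2^-1 * (c + c^-1 * x ^+ 2) = c^-1 * (2^-1 * (c ^+ 2 + x ^+ 2)).
    by field; rewrite gt_eqF.
  by rewrite ler_pdivlMl//; have := sqr_ge0 (c - x); nra.
rewrite ExZ; last by apply/itgD; [exact: itg_cst|exact: itgZ].
rewrite ExD; [|exact: itg_cst|exact: itgZ].
rewrite Ex_cst ExZ//.
have : c^-1 * E (fun w => nsq (M *m N w)) <= c.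
  rewrite ler_pdivrMl// (le_trans (Ex_nsq_mulN M))// -expr2 ler_sqr ?nnegrE ?(ltW c0)//.
  by rewrite lerDl ltW.
rewrite -/c; lra.
Qed.

(** Integration by parts trades the derivative of [p] for a factor [N], turning the sum into
    [s^-1 E (p . M N)]; then [|p . v| <= |v|] and [E |M N| <= hs_norm M]. The result is free of [B],
    so the smoothing leaves no trace in the constant. *)
Lemma hessian_bound s (p : 'cV[R]_k -> 'cV[R]_k) (Q : 'I_k -> 'cV[R]_k -> 'cV[R]_k)
    B c (M : 'M[R]_k) : 0 < s ->
  (forall y v, `|dot (p y) v| <= enorm v) ->
  (forall i, C1 (fun y => p y i 0) (Q i)) ->
  (forall i y j, `|Q i y j 0| <= B) ->
  `|\sum_i \sum_j M i j * E (fun w => Q i (c + s *: N w) j 0)| <= s^-1 * hs_norm M.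
Proof.
move=> s0 pL pQ QB.
have pB i y : `|p y i 0| <= 1.
  by rewrite -dot_delta -(enorm_delta R i); exact: pL.
have pG i := growth_bounded (fun y => pB i y).
have mp i : measurable_fun setT (fun w => p (c + s *: N w) i 0).
  exact: measurableT_comp (C1_measurable (pQ i)) (measurable_affN mN c s).
have Ip i j : itg (fun w => p (c + s *: N w) i 0 * N w j 0).
  by apply: (itgM_bounded (c := 1)) => //; exact: itg_coordN.
have -> : \sum_i \sum_j M i j * E (fun w => Q i (c + s *: N w) j 0) =
    s^-1 * E (fun w => dot (p (c + s *: N w)) (M *m N w)).
  transitivity (s^-1 * E (fun w => \sum_i \sum_j
      M i j * (p (c + s *: N w) i 0 * N w j 0))); last first.
    congr (_ * _); apply: eq_Ex => w; apply: eq_bigr => i _.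
    by rewrite mxE mulr_sumr; apply: eq_bigr => j _; ring.
  rewrite Ex_sum; last by move=> i; apply: itg_sum => j; exact: itgZ.
  rewrite mulr_sumr; apply: eq_bigr => i _.
  rewrite Ex_sum; last by move=> j; exact: itgZ.
  rewrite mulr_sumr; apply: eq_bigr => j _.
  rewrite ExZ// (gaussian_ibp mN shiftN c j s0 (pQ i) (pG i) (QB i)); ring.
rewrite normrM ger0_norm ?invr_ge0 ?(ltW s0)// ler_wpM2l ?invr_ge0 ?(ltW s0)//.
apply: le_trans (Ex_enorm_mulN M).
apply: Ex_norm_le => //; first exact: itg_enorm_mulN.
apply: measurable_sum => i; apply: measurable_funM => //.
exact: measurableT_comp (measurable_mx_entry i 0) (measurable_mulN M).
Qed.

End hessian_bound.

(** * The interpolation *)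

Lemma Ex_is_derive d (T : measurableType d) (R : realType) (P : probability T R)
    (f df : R -> T -> R) (G : T -> R) (t : R) :
  (forall s w, is_derive s (1 : R) (f ^~ w) (df s w)) ->
  (forall s, itg P (f s)) -> itg P G -> (forall s w, `|df s w| <= G w) ->
  is_derive t (1 : R) (fun s => Ex P (f s)) (Ex P (df t)).
Proof.
move=> fP If IG dfG.
(* The domination by [G] is global, so any open interval around [t] would do. *)
have It : [set` `]t - 1, t + 1[] t by rewrite /= in_itv/= ltrBlDr ltrDl ltr01.
have d1E s w : partial1of2 f s w = df s w.
  by rewrite partial1of2E; have [] := fP s w.
have G0 w : 0 <= G w by rewrite (le_trans _ (dfG t w)).
have H1 s (w : T) : [set` `]t - 1, t + 1[] s -> setT w -> derivable (f ^~ w) s 1.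
  by move=> _ _; have [] := fP s w.
have H2 s (w : T) : [set` `]t - 1, t + 1[] s -> setT w -> `|partial1of2 f s w| <= G w.
  by move=> _ _; rewrite d1E.
have If' s : [set` `]t - 1, t + 1[] s -> P.-integrable setT (EFin \o f s).
  by move=> _; exact: If.
apply: DeriveDef.
  exact: (derivable_under_integral measurableT It If' H1 G0 IG H2).
rewrite -derive1E.
rewrite [LHS](differentiation_under_integral measurableT It If' H1 G0 IG H2).
by apply: eq_Ex => w; rewrite d1E.
Qed.

Section interpolation.
Context d1 (T1 : measurableType d1) (R : realType) (P1 : probability T1 R).
Context d (T : measurableType d) (P : probability T R) (k : nat).
Variable N : T -> 'cV[R]_k.
Hypothesis mN : measurable_fun setT N.
Hypothesis shiftN : gaussian_shift_law P N.
Variable X : T1 -> 'cV[R]_k.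
Hypothesis mX : measurable_fun setT X.
Hypothesis IX : forall i, itg P1 (fun w => X w i 0).
Variable sigma : R.
Hypothesis sigma0 : 0 < sigma.
Variables (h : 'cV[R]_k -> R) (p : 'cV[R]_k -> 'cV[R]_k).
Variables (Q : 'I_k -> 'cV[R]_k -> 'cV[R]_k) (B : R).
Hypothesis hL : lip1 h.
Hypothesis hp : C1 h p.
Hypothesis pQ : forall i, C1 (fun y => p y i 0) (Q i).
Hypothesis QB : forall i y j, `|Q i y j 0| <= B.

(* The Ornstein-Uhlenbeck semigroup at time [s], with [exp (- s) = cos t]. *)
Definition ou (t : R) : 'cV[R]_k -> R := avg P N (cos t) (sigma * sin t) h.

Definition ou_grad (t : R) (x : 'cV[R]_k) : 'cV[R]_k :=
  \col_i (cos t * avg P N (cos t) (sigma * sin t) (fun y => p y i 0) x).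

(** One factor [cos t] per derivative, kept apart so that this is literally what [C1Z] applied to
    [C1_avg] produces. *)
Definition ou_hess (t : R) (i : 'I_k) (x : 'cV[R]_k) : 'cV[R]_k :=
  cos t *: \col_j (cos t * avg P N (cos t) (sigma * sin t) (fun y => Q i y j 0) x).

Let pL y v : `|dot (p y) v| <= enorm v.
Proof. exact: C1_lip1_dot hL hp _ _. Qed.

Let pB y i : `|p y i 0| <= 1.
Proof. by rewrite -dot_delta -(enorm_delta R i); exact: pL. Qed.

(** The derivative in [t] of the interpolated point [cos t x + sigma sin t N w]. *)
Let ou_speed (t : R) (x : 'cV[R]_k) w : 'cV[R]_k :=
  - sin t *: x + (sigma * cos t) *: N w.

Lemma ou_speed_bound t x y w :
  `|dot (p y) (ou_speed t x w)| <= enorm x + sigma * enorm (N w).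
Proof.
rewrite /ou_speed dotDr (le_trans (ler_normD _ _))// lerD//.
  rewrite (le_trans (pL _ _))// enormZ normrN ler_piMl ?enorm_ge0//.
  by rewrite ler_norml sin_geN1 sin_le1.
rewrite (le_trans (pL _ _))// enormZ ler_wpM2r ?enorm_ge0//.
rewrite normrM ger0_norm ?(ltW sigma0)// ler_piMr ?(ltW sigma0)//.
by rewrite ler_norml cos_geN1 cos_le1.
Qed.

Lemma ou_is_derive t x : is_derive t (1 : R) (fun s => ou s x)
  (Ex P (fun w => dot (p (cos t *: x + (sigma * sin t) *: N w)) (ou_speed t x w))).
Proof.
apply: (@Ex_is_derive _ _ _ P
  (fun s w => h (cos s *: x + (sigma * sin s) *: N w))
  (fun s w => dot (p (cos s *: x + (sigma * sin s) *: N w)) (ou_speed s x w))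
  (fun w => enorm x + sigma * enorm (N w))).
- move=> s w.
  apply: (C1_is_derive (c := fun s => cos s *: x + (sigma * sin s) *: N w) hp) => i.
  rewrite (_ : (fun s0 => _) =
      (fun s0 : R => cos s0 * x i 0 + (sigma * sin s0) * N w i 0)); last first.
    by apply/funext => s0; rewrite !mxE.
  apply: is_derive_eq.
  rewrite /ou_speed !mxE /GRing.scale/=; ring.
- move=> s.
  by have [_ _ ? _] := itg_growth mN shiftN (cos s *: x) (sigma * sin s)
    (lip1_measurable hL) (growth_lip1 hL).
- by apply: itgD; [exact: itg_cst|exact/itgZ/(itg_enormN mN shiftN)].
- by move=> s w; exact: ou_speed_bound.
Qed.

Lemma ou_lip1 t : lip1 (ou t).
Proof.
move=> x y; apply: le_trans (avg_lipschitz mN shiftN _ _ _ _ hL) _.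
by rewrite ler_piMl ?enorm_ge0// ler_norml cos_geN1 cos_le1.
Qed.

Lemma itg_enormX : itg P1 (fun w => enorm (X w)).
Proof.
have Isum : itg P1 (fun w => \sum_i `|X w i 0|).
  by apply: itg_sum => i; exact: itg_norm.
apply: (itg_le Isum).
  exact: measurableT_comp (@measurable_enorm R k) mX.
by move=> w; rewrite ger0_norm ?enorm_ge0// enorm_le_sum.
Qed.

Lemma itg_lip1X f : lip1 f -> itg P1 (fun w => f (X w)).
Proof.
move=> fL; apply: (itg_le (itgD (itg_cst P1 `|f 0|) itg_enormX)).
  exact: measurableT_comp (lip1_measurable fL) mX.
move=> w; rewrite -lerBlDl; apply: le_trans (lerB_dist _ _) _.
by rewrite -[leRHS](congr1 (@enorm R k) (subr0 (X w))); exact: fL.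
Qed.

Lemma Ex_ou_is_derive t : is_derive t (1 : R) (fun s => Ex P1 (fun w => ou s (X w)))
  (Ex P1 (fun w1 => Ex P (fun w =>
     dot (p (cos t *: X w1 + (sigma * sin t) *: N w)) (ou_speed t (X w1) w)))).
Proof.
apply: (@Ex_is_derive _ _ _ P1 (fun s w => ou s (X w))
  (fun t w1 => Ex P (fun w =>
     dot (p (cos t *: X w1 + (sigma * sin t) *: N w)) (ou_speed t (X w1) w)))
  (fun w => enorm (X w) + sigma * Ex P (fun w => enorm (N w)))).
- by move=> s w; exact: ou_is_derive.
- by move=> s; apply: itg_lip1X; exact: ou_lip1.
- by apply: itgD; [exact: itg_enormX|exact: itg_cst].
- move=> s w1.
  have IN := itg_enormN mN shiftN.
  have -> : enorm (X w1) + sigma * Ex P (fun w => enorm (N w)) =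
    Ex P (fun w => enorm (X w1) + sigma * enorm (N w)).
    rewrite ExD; [|exact: itg_cst|exact: itgZ].
    by rewrite Ex_cst ExZ.
  apply: Ex_norm_le.
  + by apply: itgD; [exact: itg_cst|exact: itgZ].
  + apply: measurable_sum => i; apply: measurable_funM.
      apply: (measurableT_comp (C1_measurable_grad i hp)).
      exact: measurable_affN.
    apply: (measurableT_comp (measurable_mx_entry i 0)).
    exact: measurable_affN.
  + by move=> w; exact: ou_speed_bound.
Qed.

(** Integration by parts in [N] replaces [E (p_i N_i)] by [sigma sin t E Q_ii]; factoring out
    [tan t] restores the powers of [cos t] held in [ou_grad] and [ou_hess]. This is the evolution
    equation of the semigroup, the bracket being its generator. *)
Lemma Ex_ou_speed t x : 0 < cos t -> 0 < sin t ->
  Ex P (fun w => dot (p (cos t *: x + (sigma * sin t) *: N w)) (ou_speed t x w)) =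
  sin t / cos t * (- dot x (ou_grad t x) + sigma ^+ 2 * \sum_i ou_hess t i x i 0).
Proof.
move=> c0 s0; set a := cos t in c0 *; set b := sin t in s0 *.
have sb0 : 0 < sigma * b by exact: mulr_gt0.
pose y w := a *: x + (sigma * b) *: N w.
have mp i : measurable_fun setT (fun w => p (y w) i 0).
  apply: (measurableT_comp (C1_measurable_grad i hp)); exact: measurable_affN.
have Ip i : itg P (fun w => p (y w) i 0).
  by apply: itg_bounded => // w; exact: pB.
have IpN i : itg P (fun w => p (y w) i 0 * N w i 0).
  by apply: (itgM_bounded (c := 1)) => //; exact: itg_coordN.
have pG i := growth_bounded (fun y => pB y i).
transitivity (Ex P (fun w => \sum_i ((- b * x i 0) * p (y w) i 0 +
    (sigma * a) * (p (y w) i 0 * N w i 0)))).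
  apply: eq_Ex => w; apply: eq_bigr => i _.
  by rewrite /ou_speed !mxE -/a -/b -/(y w); ring.
rewrite Ex_sum; last by move=> i; apply: itgD; exact: itgZ.
rewrite mulrDr mulrN -mulNr !mulr_sumr -big_split/=; apply: eq_bigr => i _.
rewrite ExD; [|exact: itgZ|exact: itgZ].
rewrite ExZ// ExZ// !mxE -/a -/b /avg.
have := gaussian_ibp mN shiftN (a *: x) i sb0 (pQ i) (pG i) (QB i).
move=> ->; rewrite -/(y _).
have sg0 : sigma != 0 by rewrite gt_eqF.
by field; rewrite ?gt_eqF//= sg0.
Qed.

End interpolation.

(** * Conditional expectations and exchangeability *)

Section pull_out.
Context d d' (T : measurableType d) (T' : measurableType d') (R : realType).
Variables (P : probability T R) (X : T -> T').
Hypothesis mX : measurable_fun setT X.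

(** The measures with densities [f] and [g] have the same image under [X], and both sides are
    integrals of [phi] against that image. *)
Lemma ge0_Ex_pull_out (f g : T -> R) (phi : T' -> R) c :
  (forall w, 0 <= f w) -> (forall w, 0 <= g w) -> itg P f -> itg P g ->
  (forall A, measurable A -> (\int[P]_(w in X @^-1` A) (f w)%:E =
                              \int[P]_(w in X @^-1` A) (g w)%:E)%E) ->
  measurable_fun setT phi -> (forall y, 0 <= phi y) -> (forall y, phi y <= c) ->
  Ex P (fun w => phi (X w) * f w) = Ex P (fun w => phi (X w) * g w).
Proof.
move=> f0 g0 If Ig fg mphi phi0 phic.
have mf := itg_measurable If; have mg := itg_measurable Ig.
have H (u : T -> R) (u0 : forall w, 0 <= u w) (mu : measurable_fun setT u) :
    (\int[P]_w (phi (X w) * u w)%:E =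
     \int[pushforward (mdensity P u0 mu) X]_y (phi y)%:E)%E.
  apply/esym.
  apply: etrans (ge0_integral_pushforward mX (mdensity P u0 mu) measurableT _ _) _.
  - exact/measurable_EFinP.
  - by move=> y _; rewrite lee_fin.
  rewrite preimage_setT.
  apply: etrans (ge0_integral_mdensity P u0 mu _ _) _.
  - by move=> w; rewrite lee_fin.
  - by apply/measurable_EFinP; exact: measurableT_comp mphi mX.
  by apply: eq_integral => w _; rewrite /= EFinM.
rewrite /Ex /Rintegral (H f f0 mf) (H g g0 mg); congr fine.
by apply: eq_measure_integral => A mA _; exact: fg.
Qed.

(* Adding [`|f| + `|g|] turns both functions into densities of measures with the
   same image under [X]. *)
Lemma Ex_pull_out (f g : T -> R) (phi : T' -> R) c : itg P f -> itg P g ->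
  (forall A, measurable A -> (\int[P]_(w in X @^-1` A) (f w)%:E =
                              \int[P]_(w in X @^-1` A) (g w)%:E)%E) ->
  measurable_fun setT phi -> (forall y, `|phi y| <= c) ->
  Ex P (fun w => phi (X w) * f w) = Ex P (fun w => phi (X w) * g w).
Proof.
move=> If Ig fg mphi phic.
pose s w := `|f w| + `|g w|.
have Is : itg P s by apply: itgD; exact: itg_norm.
have mphiX : measurable_fun setT (fun w => phi (X w)).
  exact: measurableT_comp mphi mX.
have fs0 w : 0 <= f w + s w.
  by rewrite /s addrA addr_ge0// -lerBlDl sub0r -normrN ler_norm.
have gs0 w : 0 <= g w + s w.
  by rewrite /s addrCA addr_ge0// -lerBlDl sub0r -normrN ler_norm.
have Ifs := itgD If Is; have Igs := itgD Ig Is.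
have fgs A : measurable A -> (\int[P]_(w in X @^-1` A) (f w + s w)%:E =
                              \int[P]_(w in X @^-1` A) (g w + s w)%:E)%E.
  move=> mA.
  have mXA : measurable (X @^-1` A) by rewrite -[X in measurable X]setTI; exact: mX.
  have IS u : itg P u -> P.-integrable (X @^-1` A) (EFin \o u).
    by move=> Iu; exact: (integrableS measurableT mXA (@subsetT _ _) Iu).
  have addI u : itg P u -> (\int[P]_(w in X @^-1` A) (u w + s w)%:E =
      \int[P]_(w in X @^-1` A) (u w)%:E + \int[P]_(w in X @^-1` A) (s w)%:E)%E.
    move=> Iu; have := @integralD_EFin _ _ _ P _ mXA u s (IS _ Iu) (IS _ Is).
    exact.
  by rewrite !addI// fg.
have phiI u : itg P u -> itg P (fun w => phi (X w) * u w).
  by move=> Iu; apply: (itgM_bounded (c := c)).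
(* Now all factors are nonnegative. On expansion, the terms in [s] coincide and those in [c] agree
   by [Efg], so both cancel. *)
have H : Ex P (fun w => (phi (X w) + c) * (f w + s w)) =
         Ex P (fun w => (phi (X w) + c) * (g w + s w)).
  apply: (ge0_Ex_pull_out (phi := fun y => phi y + c) (c := c + c)) => //.
  - by apply: measurable_funD => //; exact: measurable_cst.
  - by move=> y; have := phic y; rewrite ler_norml => /andP[]; lra.
  - by move=> y; have := phic y; rewrite ler_norml => /andP[]; lra.
have Efg : Ex P f = Ex P g.
  by have := fg setT measurableT; rewrite preimage_setT /Ex /Rintegral => ->.
have expand u : itg P u -> Ex P (fun w => (phi (X w) + c) * (u w + s w)) =
    Ex P (fun w => phi (X w) * u w) + c * Ex P u +
    Ex P (fun w => (phi (X w) + c) * s w).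
  move=> Iu; have Ius : itg P (fun w => (phi (X w) + c) * s w).
    apply: eq_itg (itgD (phiI _ Is) (itgZ c Is)) => w; ring.
  rewrite -ExZ// -ExD ?phiI//; last exact: itgZ.
  rewrite -ExD//; last by apply: itgD; [exact: phiI|exact: itgZ].
  by apply: eq_Ex => w; ring.
by move: H; rewrite !expand// Efg => /addIr /addIr.
Qed.

End pull_out.

Lemma Ex_cond_exp d d' (T : measurableType d) (T' : measurableType d')
    (R : realType) (P : probability T R) (X : {RV P >-> T'}) m n
    (Y C : T -> 'M[R]_(m, n)) (phi : T' -> R) c i j :
  is_cond_exp X Y C -> itg P (fun w => Y w i j) ->
  measurable_fun setT phi -> (forall y, `|phi y| <= c) ->
  Ex P (fun w => phi (X w) * C w i j) = Ex P (fun w => phi (X w) * Y w i j).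
Proof.
move=> /(_ i j)[IC _ YC] IY mphi phic.
apply: (Ex_pull_out (X := X) _ IC IY _ mphi phic); first exact: measurable_funPT.
by move=> A mA; apply: YC; exists A => //; rewrite setTI.
Qed.

(** * The second-order Taylor remainder, small and large increments *)

Section remainder.
Context (R : realType) (k : nat).
Variables (f : 'cV[R]_k -> R) (p : 'cV[R]_k -> 'cV[R]_k).
Variables (H : 'I_k -> 'cV[R]_k -> 'cV[R]_k) (B : R).
Hypothesis fL : lip1 f.
Hypothesis fp : C1 f p.
Hypothesis pH : forall i, C1 (fun y => p y i 0) (H i).
Hypothesis HB : forall i y j, `|H i y j 0| <= B.

Definition taylor2_rem (y d : 'cV[R]_k) : R :=
  f (y + d) - f y - dot (p y) d - 2^-1 * \sum_i d i 0 * dot (H i y) d.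

(** Shaped for the hypotheses on [X_eps]: the first term is small with [t] once multiplied by the
    bounded second moment, the second is the truncated moment of [hiii] with [rho = t^2]. *)
Lemma taylor2_rem_bound : exists K0 K1 r : R, [/\ 0 <= K0, 0 <= K1, 0 < r &
  forall t, 0 < t -> t ^+ 2 <= r -> forall y d,
    `|taylor2_rem y d| <= K0 * t * nsq d + K1 * (nsq d * (t ^+ 2 < nsq d)%R%:R)].
Proof.
have [K [r [r0 HK]]] := C1_second_order fp pH.
(* [|K| (1 + r)] serves for [t^2 < |d|^2 <= r], where the third-order bound still holds and
   [|d| <= 1 + r]. For [|d|^2 > r], the increment of [f] and its linear part each cost [1 + 1/r],
   and the last summand is the Hessian term. *)
pose K1 := `|K| * (1 + r) + (2 * (1 + r^-1) + 2^-1 * (\sum_(i < k) \sum_(j < k) `|B|)).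
have S0 : 0 <= \sum_(i < k) \sum_(j < k) `|B|.
  by apply: sumr_ge0 => i _; apply: sumr_ge0.
have K10 : 0 <= K1.
  by rewrite !addr_ge0 ?mulr_ge0 ?addr_ge0 ?invr_ge0 ?(ltW r0)// invr_ge0.
exists `|K|, K1, r; split => // t t0 tr y d.
have n0 := nsq_ge0 d; have e0 := enorm_ge0 d.
case: ltP => [td|dt]; last first.
  rewrite !mulr0 addr0; apply: le_trans (HK _ _ (le_trans dt tr)) _.
  rewrite -mulrA mulrCA [t * _]mulrC mulrA [nsq d * _]mulrC -mulrA.
  apply: le_trans (ler_wpM2r _ (ler_norm K)) _; first exact: mulr_ge0.
  rewrite ler_wpM2l// ler_wpM2l//.
  by rewrite -ler_sqr ?nnegrE ?(ltW t0)// sqr_enorm.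
rewrite mulr1; apply: (@le_trans _ _ (K1 * nsq d)); last first.
  by rewrite lerDr !mulr_ge0// ltW.
have [dr|rd] := leP (nsq d) r.
  apply: le_trans (HK _ _ dr) _.
  apply: le_trans (ler_wpM2r _ (ler_norm K)) _; first exact: mulr_ge0.
  rewrite mulrA mulrAC ler_wpM2r// (@le_trans _ _ (`|K| * (1 + r)))//.
    by rewrite ler_wpM2l// (le_trans (enorm_le_nsq d))// lerD2l.
  rewrite lerDl addr_ge0// mulr_ge0// ?addr_ge0// ?invr_ge0// ltW//.
have e1 : enorm d <= (1 + r^-1) * nsq d.
  rewrite (le_trans (enorm_le_nsq d))// mulrDl mul1r addrC lerD2l.
  by rewrite -ler_pdivrMl ?invr_gt0// invrK mulr1 ltW.
have b1 : `|f (y + d) - f y| <= enorm d.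
  by have := fL (y + d) y; rewrite addrAC subrr add0r.
have b2 : `|dot (p y) d| <= enorm d by exact: C1_lip1_dot fL fp _ _.
have b3 : `|2^-1 * \sum_i d i 0 * dot (H i y) d| <=
    2^-1 * (\sum_(i < k) \sum_(j < k) `|B|) * nsq d.
  rewrite normrM ger0_norm// -mulrA ler_wpM2l//.
  apply: le_trans (ler_norm_sum _ _ _) _; rewrite mulr_suml ler_sum// => i _.
  rewrite /dot mulr_sumr; apply: le_trans (ler_norm_sum _ _ _) _.
  rewrite mulr_suml ler_sum// => j _.
  rewrite mulrCA normrM ler_pM//.
    by rewrite (le_trans (HB _ _ _))// ler_norm.
  by rewrite normrM -sqr_enorm expr2 ler_pM// le_enorm.
rewrite /taylor2_rem.
apply: le_trans (ler_normB _ _) _; apply: le_trans (lerD (ler_normB _ _) b3) _.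
apply: le_trans (lerD (lerD b1 b2) (lexx _)) _.
have : 0 <= `|K| * (1 + r) * nsq d by rewrite !mulr_ge0// addr_ge0// ltW.
rewrite /K1 !mulrDl; lra.
Qed.

End remainder.

(** * The approximate Stein identity and its limit *)

Section stein_identity.
Context (R : realType) (k : nat) (d : measure_display) (T : measurableType d).
Context (P : probability T R).
Variables (X : {RV P >-> 'cV[R]_k}) (Xe : R -> {RV P >-> 'cV[R]_k}).
Hypothesis Xe_law : forall eps : R, 0 < eps -> same_distribution (Xe eps) X.
Variables (sigma : R) (lambda : R -> R).
Hypothesis lambda_gt0 : forall eps : R, 0 < eps -> 0 < lambda eps.
Variable F : {RV P >-> 'M[R]_k}.
Hypothesis int_diff : forall eps : R, 0 < eps ->
    mx_integrable P (fun w => Xe eps w - X w).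
Hypothesis int_diff2 : forall eps : R, 0 < eps ->
    mx_integrable P (fun w => (Xe eps w - X w) *m (Xe eps w - X w)^T).
Hypothesis int_F : mx_integrable P F.
Variable E1 : R -> T -> 'cV[R]_k.
Hypothesis E1P : forall eps : R, 0 < eps ->
    is_cond_exp X (fun w => Xe eps w - X w) (E1 eps).
Variable E2 : R -> T -> 'M[R]_k.
Hypothesis E2P : forall eps : R, 0 < eps ->
    is_cond_exp X (fun w => (Xe eps w - X w) *m (Xe eps w - X w)^T) (E2 eps).
Variable EF : T -> 'M[R]_k.
Hypothesis EFP : is_cond_exp X F EF.
Hypothesis hi : cvg_L1_at0 P (fun eps w => (lambda eps)^-1 *: E1 eps w)
                     (fun w => - X w).
Hypothesis hii : cvg_L1_at0 P (fun eps w => (2 * lambda eps)^-1 *: E2 eps w)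
                      (fun w => (sigma ^+ 2)%:M + EF w).
Hypothesis hiii : forall rho : R, 0 < rho ->
    (((lambda eps)^-1)%:E *
      'E_P[fun w => (enorm (Xe eps w - X w) ^+ 2 *
                     \1_[set v | rho < enorm (Xe eps v - X v) ^+ 2] w)%R])%E
      @[eps --> 0^'+] --> 0%E.

Let D eps w : 'cV[R]_k := Xe eps w - X w.

(** Convergence in [hi] forces [E1 / lambda + X] to have finite mean absolute value for small [eps];
    subtracting the integrable [E1 / lambda] leaves [X]. *)
Lemma exchangeable_integrable i : itg P (fun w => X w i 0).
Proof.
have mXi : measurable_fun setT (fun w => X w i 0).
  exact: measurableT_comp (measurable_mx_entry i 0) (measurable_funPT X).
have := hi i 0 => /fine_cvgP[fin_near _].
near (0 : R)^'+ => e.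
have e0 : 0 < e by near: e; exact: nbhs_right_gt.
have Efin : 'E_P[fun w => `|(((lambda e)^-1 *: E1 e w) i 0 - (- X w) i 0)|%R]%E
    \is a fin_num by near: e; exact: fin_near.
have [IE1 _ _] := E1P e0 i 0.
have IlE1 : itg P (fun w => (lambda e)^-1 * E1 e w i 0) by exact: itgZ.
have IS : itg P (fun w => (lambda e)^-1 * E1 e w i 0 + X w i 0).
  apply/integrableP; split.
    by apply/measurable_EFinP; apply: measurable_funD => //; exact: itg_measurable IlE1.
  move: Efin; rewrite unlock ge0_fin_numE; last first.
    by apply: integral_ge0 => w _; rewrite lee_fin.
  by under eq_integral do rewrite !mxE opprK.
by apply: eq_itg (itgB IS IlE1) => w; rewrite addrAC subrr add0r.
Unshelve. all: end_near. Qed.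

Lemma cvg_L1_Ex m n (Y : R -> T -> 'M[R]_(m, n)) (L : T -> 'M[R]_(m, n)) i j :
  cvg_L1_at0 P Y L ->
  Ex P (fun w => `|Y eps w i j - L w i j|) @[eps --> 0^'+] --> 0.
Proof.
by move=> /(_ i j) /fine_cvgP[_]; rewrite unlock.
Qed.

Lemma measurable_diff eps : measurable_fun setT (D eps).
Proof.
apply: measurable_fun_mx => i j; under eq_fun do rewrite !mxE.
apply: measurable_funB.
  exact: measurableT_comp (measurable_mx_entry i j) (measurable_funPT (Xe eps)).
exact: measurableT_comp (measurable_mx_entry i j) (measurable_funPT X).
Qed.

Lemma itg_diff eps i : 0 < eps -> itg P (fun w => D eps w i 0).
Proof. by move=> e0; exact: int_diff. Qed.

Lemma itg_diffM eps i j : 0 < eps -> itg P (fun w => D eps w i 0 * D eps w j 0).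
Proof.
move=> e0; apply: eq_itg (int_diff2 e0 i j) => w.
by rewrite mxE big_ord1 [(_^T) 0 j]mxE.
Qed.

Lemma itg_nsq_diff eps : 0 < eps -> itg P (fun w => nsq (D eps w)).
Proof. by move=> e0; apply: itg_sum => i; exact: itg_diffM. Qed.

Lemma measurable_tail eps t :
  measurable_fun setT (fun w => (t < nsq (D eps w))%R%:R : R).
Proof.
have mA : measurable ((fun w => nsq (D eps w)) @^-1` `]t, +oo[%classic).
  rewrite -[X in measurable X]setTI.
  by apply: (measurableT_comp (@measurable_nsq R k) (measurable_diff eps)).
have -> : (fun w => (t < nsq (D eps w))%R%:R) =
    \1_((fun w => nsq (D eps w)) @^-1` `]t, +oo[%classic) :> (T -> R).
  apply/funext => w; rewrite indicE; congr (nat_of_bool _)%:R.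
  apply/idP/idP => [H|/set_mem/=]; last by rewrite in_itv/= andbT.
  by apply/mem_set; rewrite /= in_itv/= H.
exact: measurable_indic.
Qed.

Lemma itg_tail eps t : 0 < eps ->
  itg P (fun w => nsq (D eps w) * (t < nsq (D eps w))%R%:R).
Proof.
move=> e0; apply: eq_itg (itgM_bounded (c := 1) (itg_nsq_diff e0)
  (measurable_tail eps t) _) => w; first by rewrite mulrC.
by rewrite normr_nat lern1 leq_b1.
Qed.

Lemma cvg_tail t : 0 < t ->
  (lambda eps)^-1 * Ex P (fun w => nsq (D eps w) * (t < nsq (D eps w))%R%:R)
    @[eps --> 0^'+] --> 0.
Proof.
move=> t0; have := hiii t0 => /fine_cvgP[_].
apply: cvg_trans; apply: near_eq_cvg; near=> eps.
have e0 : 0 < eps by near: eps; exact: nbhs_right_gt.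
have E : (fun w => enorm (Xe eps w - X w) ^+ 2 *
       \1_[set v | t < enorm (Xe eps v - X v) ^+ 2] w) =
  (fun w => nsq (D eps w) * (t < nsq (D eps w))%R%:R).
  apply/funext => w; rewrite sqr_enorm indicE; congr (_ * (nat_of_bool _)%:R).
  apply/idP/idP => [/set_mem/=|H]; first by rewrite sqr_enorm.
  by apply/mem_set; rewrite /= sqr_enorm.
by rewrite /= E unlock Ex_EFin//; exact: itg_tail.
Unshelve. all: end_near. Qed.

Variables (f : 'cV[R]_k -> R) (p : 'cV[R]_k -> 'cV[R]_k).
Variables (H : 'I_k -> 'cV[R]_k -> 'cV[R]_k) (B : R).
Hypothesis fL : lip1 f.
Hypothesis fp : C1 f p.
Hypothesis pH : forall i, C1 (fun y => p y i 0) (H i).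
Hypothesis HB : forall i y j, `|H i y j 0| <= B.

Let pB y i : `|p y i 0| <= 1.
Proof. by rewrite -dot_delta -(enorm_delta R i); exact: C1_lip1_dot fL fp _ _. Qed.

Let mp i : measurable_fun setT (fun y => p y i 0).
Proof. exact: C1_measurable_grad fp. Qed.

Let mH i j : measurable_fun setT (fun y => H i y j 0).
Proof. exact: C1_measurable_grad (pH i). Qed.

Let mX : measurable_fun setT X := measurable_funPT X.

Lemma exchangeable_itg_f eps : 0 < eps ->
  itg P (fun w => f (X w)) /\ itg P (fun w => f (Xe eps w)).
Proof.
move=> e0; have IX := exchangeable_integrable.
split; first exact: itg_lip1X mX IX _ fL.
apply: (itg_lip1X (measurable_funPT (Xe eps)) _ fL) => i.
by apply: eq_itg (itgD (itg_diff i e0) (IX i)) => w; rewrite /D !mxE subrK.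
Qed.

(** Here the equality of the laws enters: both expectations are integrals of [f] against a
    distribution. *)
Lemma exchangeable_Ex_f eps : 0 < eps ->
  Ex P (fun w => f (Xe eps w)) = Ex P (fun w => f (X w)).
Proof.
move=> e0; have [IfX IfXe] := exchangeable_itg_f e0.
have mf : measurable_fun setT (EFin \o f).
  by apply/measurable_EFinP; exact: lip1_measurable.
rewrite /Ex /Rintegral; congr fine.
rewrite -[LHS](integral_distribution mf IfXe) -[RHS](integral_distribution mf IfX).
by apply: eq_measure_integral => A mA _; exact: Xe_law.
Qed.

(** [u] and [v] are the errors whose [L_1] norms vanish by [hi] and [hii]. *)
Let u i eps w := ((lambda eps)^-1 *: E1 eps w) i 0 - (- X w) i 0.
Let v i j eps w := ((2 * lambda eps)^-1 *: E2 eps w) i j - ((sigma ^+ 2)%:M + EF w) i j.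

(** An exact identity for each [eps]: take the expectation of the Taylor expansion of
    [f(X_eps) - f(X)], divide by [lambda eps], and write each conditional moment as its limit plus
    an error. *)
Lemma stein_expansion eps : 0 < eps ->
  Ex P (fun w => - dot (X w) (p (X w)) + sigma ^+ 2 * \sum_i H i (X w) i 0) +
  Ex P (fun w => \sum_i \sum_j F w i j * H i (X w) j 0) =
  - (\sum_i Ex P (fun w => p (X w) i 0 * u i eps w))
  - (\sum_i \sum_j Ex P (fun w => H i (X w) j 0 * v i j eps w))
  - (lambda eps)^-1 * Ex P (fun w => taylor2_rem f p H (X w) (D eps w)).
Proof.
move=> e0; have l0 := lambda_gt0 e0.
have IX := exchangeable_integrable.
have pI i g : itg P g -> itg P (fun w => p (X w) i 0 * g w).
  by move=> Ig; apply: (itgM_bounded (c := 1)) => //; exact: measurableT_comp (mp i) mX.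
have HI i j g : itg P g -> itg P (fun w => H i (X w) j 0 * g w).
  by move=> Ig; apply: (itgM_bounded (c := B)) => //; exact: measurableT_comp (mH i j) mX.
have IE1 i : itg P (fun w => E1 eps w i 0) by have [] := E1P e0 i 0.
have IE2 i j : itg P (fun w => E2 eps w i j) by have [] := E2P e0 i j.
have IEF i j : itg P (fun w => EF w i j) by have [] := EFP i j.
have IF i j : itg P (fun w => F w i j) by exact: int_F.
have ID i := itg_diff i e0.
have IDD i j := itg_diffM i j e0.
have IH i j : itg P (fun w => H i (X w) j 0).
  by apply: (@itg_bounded _ _ _ _ B) => //; exact: measurableT_comp (mH i j) mX.
have Is i j : itg P (fun w => (sigma ^+ 2)%:M i j + EF w i j).
  by apply: itgD => //; exact: itg_cst.
(* [A1] to [A3] exchange a variable for its conditional expectation against a bounded function of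
   [X]. *)
have A1 i : Ex P (fun w => p (X w) i 0 * E1 eps w i 0) =
            Ex P (fun w => p (X w) i 0 * D eps w i 0).
  exact: (Ex_cond_exp (phi := fun y => p y i 0) (E1P e0) (ID i) (mp i) (fun y => pB y i)).
have A2 i j : Ex P (fun w => H i (X w) j 0 * E2 eps w i j) =
              Ex P (fun w => H i (X w) j 0 * (D eps w i 0 * D eps w j 0)).
  rewrite (Ex_cond_exp (phi := fun y => H i y j 0) (c := B) (E2P e0)) //.
  - by apply: eq_Ex => w; rewrite mxE big_ord1 [(_^T) 0 j]mxE.
  - exact: int_diff2.
have A3 i j : Ex P (fun w => H i (X w) j 0 * EF w i j) =
              Ex P (fun w => H i (X w) j 0 * F w i j).
  exact: (Ex_cond_exp (phi := fun y => H i y j 0) (c := B) EFP).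
pose S1 := \sum_i Ex P (fun w => p (X w) i 0 * D eps w i 0).
pose S2 := \sum_i \sum_j Ex P (fun w => H i (X w) j 0 * (D eps w i 0 * D eps w j 0)).
(* The expansion sums to zero because [f(X_eps)] and [f(X)] have the same mean. *)
have S12 : S1 + 2^-1 * S2 + Ex P (fun w => taylor2_rem f p H (X w) (D eps w)) = 0.
  have [IfX IfXe] := exchangeable_itg_f e0.
  have I1 : itg P (fun w => \sum_i p (X w) i 0 * D eps w i 0).
    by apply: itg_sum => i; exact: pI.
  have I2 : itg P (fun w => \sum_i \sum_j
      H i (X w) j 0 * (D eps w i 0 * D eps w j 0)).
    by apply: itg_sum => i; apply: itg_sum => j; exact: HI.
  have remE w : taylor2_rem f p H (X w) (D eps w) =
     f (Xe eps w) - f (X w) - (\sum_i p (X w) i 0 * D eps w i 0) -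
     2^-1 * \sum_i \sum_j H i (X w) j 0 * (D eps w i 0 * D eps w j 0).
    rewrite /taylor2_rem [X w + _]addrC subrK; congr (_ - _ - 2^-1 * _).
    apply: eq_bigr => i _; rewrite /dot mulr_sumr; apply: eq_bigr => j _; ring.
  have Id := itgB IfXe IfX.
  have Id1 := itgB Id I1.
  rewrite (eq_Ex P remE) ExB//; last exact: itgZ.
  rewrite ExB// ExB// ExZ// exchangeable_Ex_f// subrr Ex_sum; last by move=> i; exact: pI.
  rewrite Ex_sum; last by move=> i; apply: itg_sum => j; exact: HI.
  rewrite -/S1 (eq_bigr (fun i => \sum_j
    Ex P (fun w => H i (X w) j 0 * (D eps w i 0 * D eps w j 0)))).
    by rewrite -/S2; ring.
  by move=> i _; rewrite Ex_sum// => j; exact: HI.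
pose U1 := \sum_i Ex P (fun w => p (X w) i 0 * X w i 0).
pose U2 := \sum_i \sum_j Ex P (fun w => H i (X w) j 0 * ((sigma ^+ 2)%:M i j + EF w i j)).
have B1 : \sum_i Ex P (fun w => p (X w) i 0 * u i eps w) = (lambda eps)^-1 * S1 + U1.
  rewrite mulr_sumr -big_split; apply: eq_bigr => i _ /=.
  rewrite -A1 -ExZ ?pI// -ExD ?pI//; last exact/itgZ/pI.
  by apply: eq_Ex => w; rewrite /u !mxE; ring.
have B2 : \sum_i \sum_j Ex P (fun w => H i (X w) j 0 * v i j eps w) =
    (2 * lambda eps)^-1 * S2 - U2.
  rewrite mulr_sumr -sumrB; apply: eq_bigr => i _ /=.
  rewrite mulr_sumr -sumrB; apply: eq_bigr => j _ /=.
  rewrite -A2 -ExZ ?HI// -ExB ?HI//; last exact/itgZ/HI.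
  by apply: eq_Ex => w; rewrite /v !mxE; ring.
have B3 : Ex P (fun w => - dot (X w) (p (X w)) + sigma ^+ 2 * \sum_i H i (X w) i 0) +
    Ex P (fun w => \sum_i \sum_j F w i j * H i (X w) j 0) = U2 - U1.
  have I1 : itg P (fun w => \sum_i p (X w) i 0 * X w i 0).
    by apply: itg_sum => i; exact: pI.
  have I2 : itg P (fun w => \sum_i H i (X w) i 0) by exact: itg_sum.
  have -> : Ex P (fun w => - dot (X w) (p (X w)) + sigma ^+ 2 * \sum_i H i (X w) i 0) =
      sigma ^+ 2 * (\sum_i Ex P (fun w => H i (X w) i 0)) - U1.
    rewrite /U1 -Ex_sum// -Ex_sum; last by move=> i; exact: pI.
    rewrite -ExZ// -ExB//; last exact: itgZ.
    by apply: eq_Ex => w; rewrite dotC addrC.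
  have -> : Ex P (fun w => \sum_i \sum_j F w i j * H i (X w) j 0) =
      \sum_i \sum_j Ex P (fun w => H i (X w) j 0 * F w i j).
    rewrite Ex_sum; last first.
      move=> i; apply: itg_sum => j; apply: eq_itg (HI i j _ (IF i j)) => w.
      by rewrite mulrC.
    apply: eq_bigr => i _; rewrite Ex_sum.
      by apply: eq_bigr => j _; apply: eq_Ex => w; rewrite mulrC.
    by move=> j; apply: eq_itg (HI i j _ (IF i j)) => w; rewrite mulrC.
  rewrite addrAC mulr_sumr -big_split/=; congr (_ - _).
  apply: eq_bigr => i _.
  transitivity (\sum_j (Ex P (fun w => H i (X w) j 0 * (sigma ^+ 2)%:M i j) +
                        Ex P (fun w => H i (X w) j 0 * F w i j))).
    rewrite big_split/=; congr (_ + _).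
    rewrite (bigD1 i)//= big1 ?addr0.
      rewrite -ExZ//; apply: eq_Ex => w; rewrite !mxE eqxx mulr1n mulrC//.
    move=> j /negbTE ji; rewrite -[RHS](Ex_cst P); apply: eq_Ex => w.
    by rewrite !mxE eq_sym ji mulr0n mulr0.
  apply: eq_bigr => j _; rewrite -A3 -ExD ?HI//; last exact: itg_cst.
  by apply: eq_Ex => w; rewrite mulrDr.
rewrite B3 B1 B2.
have -> : Ex P (fun w => taylor2_rem f p H (X w) (D eps w)) = - (S1 + 2^-1 * S2).
  by apply/eqP; rewrite -addr_eq0 addrC S12.
by field; rewrite gt_eqF.
Qed.

(** [a] and [b] total the errors of [hi] and [hii], [c t] is the scaled second moment beyond
    [|d| = t], and [M] controls the trace of the limit in [hii]. *)
Let a eps := \sum_i Ex P (fun w => `|u i eps w|).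
Let b eps := \sum_i \sum_j Ex P (fun w => `|v i j eps w|).
Let c t eps := (lambda eps)^-1 *
  Ex P (fun w => nsq (D eps w) * (t ^+ 2 < nsq (D eps w))%R%:R).
Let M := \sum_i Ex P (fun w => `|((sigma ^+ 2)%:M + EF w) i i|).

Let itg_u i eps : 0 < eps -> itg P (u i eps).
Proof.
move=> e0; have [IE1 _ _] := E1P e0 i 0; have IX := exchangeable_integrable i.
by apply: eq_itg (itgD (itgZ (lambda eps)^-1 IE1) IX) => w; rewrite /u !mxE opprK.
Qed.

Let itg_target i j : itg P (fun w => ((sigma ^+ 2)%:M + EF w) i j).
Proof.
have [IEF _ _] := EFP i j.
by apply: eq_itg (itgD (itg_cst P ((sigma ^+ 2)%:M i j)) IEF) => w; rewrite [RHS]mxE.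
Qed.

Let itg_v i j eps : 0 < eps -> itg P (v i j eps).
Proof.
move=> e0; have [IE2 _ _] := E2P e0 i j.
apply: eq_itg (itgB (itgZ (2 * lambda eps)^-1 IE2) (itg_target i j)) => w.
by rewrite /v [in RHS]mxE.
Qed.

(** The trace of [hii]: the mean of [|X_eps - X|^2] is that of the trace of [E2], and the factor [2]
    undoes the normalization [1 / (2 lambda)]. *)
Lemma Ex_nsq_diff_bound eps : 0 < eps ->
  (lambda eps)^-1 * Ex P (fun w => nsq (D eps w)) <= 2 * (b eps + M).
Proof.
move=> e0; have l0 := lambda_gt0 e0.
have IDD i := itg_diffM i i e0.
have IE2 i : itg P (fun w => E2 eps w i i) by have [] := E2P e0 i i.
have E2E i : Ex P (fun w => D eps w i 0 * D eps w i 0) = Ex P (fun w => E2 eps w i i).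
  have n1 : forall y : 'cV[R]_k, `|1 : R| <= (1 : R) by move=> _; rewrite normr1.
  have m1 : measurable_fun setT (fun _ : 'cV[R]_k => 1 : R) by exact: measurable_cst.
  (* Pulling out the constant [1] says that conditioning preserves the mean. *)
  have CE := Ex_cond_exp (E2P e0) (int_diff2 e0 i i) m1 n1.
  transitivity (Ex P (fun w => 1 * E2 eps w i i)); last first.
    by apply: eq_Ex => w; rewrite mul1r.
  by rewrite CE; apply: eq_Ex => w; rewrite [RHS]mul1r [RHS]mxE big_ord1 [(_^T) 0 i]mxE.
have -> : (lambda eps)^-1 * Ex P (fun w => nsq (D eps w)) =
    2 * \sum_i Ex P (fun w => (2 * lambda eps)^-1 * E2 eps w i i).
  rewrite Ex_sum// !mulr_sumr; apply: eq_bigr => i _.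
  by rewrite E2E ExZ//; field; rewrite gt_eqF.
rewrite ler_wpM2l// /b /M -big_split/= ler_sum// => i _.
apply: (@le_trans _ _ (Ex P (fun w => `|v i i eps w|) +
    Ex P (fun w => `|((sigma ^+ 2)%:M + EF w) i i|))).
  rewrite -ExD; [|exact/itg_norm/itg_v|exact/itg_norm/itg_target].
  apply: Ex_le; [exact: itgZ| |].
    by apply: itgD; [exact/itg_norm/itg_v|exact/itg_norm/itg_target].
  move=> w; rewrite (le_trans _ (ler_normD _ _))//.
  by rewrite /v subrK mxE ler_norm.
by rewrite lerD2r (bigD1 i)//= lerDl sumr_ge0// => j _; exact: Ex_ge0.
Qed.

Lemma stein_identity :
  Ex P (fun w => - dot (X w) (p (X w)) + sigma ^+ 2 * \sum_i H i (X w) i 0) =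
  - Ex P (fun w => \sum_i \sum_j F w i j * H i (X w) j 0).
Proof.
apply/eqP; rewrite -addr_eq0; set L := _ + _.
have [K0 [K1 [r [K00 K10 r0 remB]]]] := taylor2_rem_bound fL fp pH HB.
(* [L] depends on neither [eps] nor [t]. The four terms bound the errors of [hi] and [hii] and the
   Taylor remainder below and above [|d| = t]. *)
have boundL eps t : 0 < eps -> 0 < t -> t ^+ 2 <= r ->
    `|L| <= a eps + `|B| * b eps + K0 * t * (2 * (b eps + M)) + K1 * c t eps.
  move=> e0 t0 tr; have l0 := lambda_gt0 e0.
  rewrite /L (stein_expansion e0) -!opprD normrN.
  apply: le_trans (ler_normD _ _) _; rewrite -addrA lerD//.
    apply: le_trans (ler_normD _ _) _; rewrite lerD//.
      apply: le_trans (ler_norm_sum _ _ _) _; rewrite ler_sum// => i _.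
      apply: Ex_norm_le; first exact/itg_norm/itg_u.
        apply: measurable_funM; first exact: measurableT_comp (mp i) mX.
        exact/itg_measurable/itg_u.
      by move=> w; rewrite normrM ler_piMl.
    rewrite mulr_sumr; apply: le_trans (ler_norm_sum _ _ _) _; rewrite ler_sum// => i _.
    rewrite mulr_sumr; apply: le_trans (ler_norm_sum _ _ _) _; rewrite ler_sum// => j _.
    rewrite -ExZ; last exact/itg_norm/itg_v.
    apply: Ex_norm_le; first exact/itgZ/itg_norm/itg_v.
      apply: measurable_funM; first exact: measurableT_comp (mH i j) mX.
      exact/itg_measurable/itg_v.
    by move=> w; rewrite normrM ler_wpM2r// (le_trans (HB _ _ _))// ler_norm.
  have I1 := itg_nsq_diff e0; have I2 := itg_tail (t ^+ 2) e0.
  rewrite normrM ger0_norm ?invr_ge0 ?(ltW l0)//.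
  apply: (@le_trans _ _ ((lambda eps)^-1 * (K0 * t * Ex P (fun w => nsq (D eps w)) +
     K1 * Ex P (fun w => nsq (D eps w) * (t ^+ 2 < nsq (D eps w))%R%:R)))).
    rewrite ler_wpM2l ?invr_ge0 ?(ltW l0)// -ExZ// -ExZ// -ExD; [|exact: itgZ|exact: itgZ].
    have IR := itgD (itgZ (K0 * t) I1) (itgZ K1 I2).
    apply: (Ex_norm_le IR); last by move=> w; exact: remB.
    apply: measurable_funB; last first.
      apply: measurable_funM => //; apply: measurable_sum => i.
      apply: measurable_funM; first exact/itg_measurable/itg_diff.
      apply: measurable_sum => j; apply: measurable_funM; last exact/itg_measurable/itg_diff.
      exact: measurableT_comp (mH i j) mX.
    apply: measurable_funB; last first.
      apply: measurable_sum => i; apply: measurable_funM; last exact/itg_measurable/itg_diff.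
      exact: measurableT_comp (mp i) mX.
    have [IfX IfXe] := exchangeable_itg_f e0.
    apply: measurable_funB; last exact: itg_measurable IfX.
    under eq_fun do rewrite [X _ + _]addrC subrK.
    exact: itg_measurable IfXe.
  rewrite mulrDr lerD//; last by rewrite /c mulrCA.
  rewrite mulrCA ler_wpM2l//; first by rewrite mulr_ge0// ltW.
  exact: Ex_nsq_diff_bound.
have a0 : a eps @[eps --> 0^'+] --> 0.
  rewrite -[X in _ --> X](_ : \sum_(i < k) 0 = 0 :> R); last by rewrite big1.
  by apply: cvg_sumr => i; exact: (cvg_L1_Ex i 0 hi).
have b0 : b eps @[eps --> 0^'+] --> 0.
  rewrite -[X in _ --> X](_ : \sum_(i < k) \sum_(j < k) 0 = 0 :> R); last first.
    by rewrite big1// => i _; rewrite big1.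
  apply: cvg_sumr => i; apply: cvg_sumr => j; exact: (cvg_L1_Ex i j hii).
(* Limit in [eps] at fixed [t]: only the contribution of small increments survives, and it is linear
   in [t]. *)
have limL t : 0 < t -> t ^+ 2 <= r -> `|L| <= K0 * t * (2 * M).
  move=> t0 tr.
  have G : a eps + `|B| * b eps + K0 * t * (2 * (b eps + M)) + K1 * c t eps
      @[eps --> 0^'+] --> 0 + `|B| * 0 + K0 * t * (2 * (0 + M)) + K1 * 0.
    apply: cvgD; last first.
      apply: cvgM; first exact: cvg_cst.
      by apply: cvg_tail; rewrite exprn_gt0.
    apply: cvgD.
      by apply: cvgD => //; apply: cvgM => //; exact: cvg_cst.
    apply: cvgM; first exact: cvg_cst.
    apply: cvgM; first exact: cvg_cst.
    by apply: cvgD => //; exact: cvg_cst.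
  rewrite mulr0 mulr0 !addr0 !add0r in G.
  apply: (cvgr_to_ge G); apply: filterS (nbhs_right_gt 0) => eps e0.
  exact: boundL.
rewrite -normr_le0; apply/ler_addgt0Pr => e e0; rewrite add0r.
have M0 : 0 <= M by apply: sumr_ge0 => i _; exact: Ex_ge0.
have C0 : 0 < K0 * (2 * M) + 1 by rewrite ltr_wpDl// !mulr_ge0.
(* [t <= 1] and [t <= r] give [t^2 <= r]; the last bound makes [2 K0 M t <= e]. *)
pose t := Num.min (Num.min 1 r) (e / (K0 * (2 * M) + 1)).
have t0 : 0 < t by rewrite !lt_min ltr01 r0 divr_gt0.
have : t <= t by []; rewrite {2}/t !le_min => /andP[/andP[t1 tr] te].
apply: le_trans (limL t t0 _) _.
  by apply: le_trans tr; rewrite expr2 ler_piMr// ltW.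
move: te; rewrite ler_pdivlMr// => te; apply: le_trans te.
by rewrite mulrAC [K0 * _ * t]mulrC ler_wpM2l ?(ltW t0)// lerDl.
Qed.

End stein_identity.

(** * The distance bound *)

Lemma dot_trmx (R : realType) m n (A : 'M[R]_(m, n)) v x :
  dot (A^T *m v) x = dot v (A *m x).
Proof.
have dotE l (a b : 'cV[R]_l) : dot a b = (a^T *m b) 0 0.
  by rewrite mxE; apply: eq_bigr => i _; rewrite mxE.
by rewrite !dotE trmx_mul trmxK mulmxA.
Qed.

Lemma measurable_mulmx_cV (R : realType) m n (A : 'M[R]_(m, n)) :
  measurable_fun setT (fun x : 'cV[R]_n => A *m x).
Proof.
apply: measurable_fun_mx => i j; rewrite ord1; under eq_fun do rewrite mxE.
apply: measurable_sum => l; apply: measurable_funM; first exact: measurable_cst.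
exact: measurable_mx_entry.
Qed.

Lemma measurable_scalecV (R : realType) n (c : R) d (T : measurableType d)
    (f : T -> 'cV[R]_n) : measurable_fun setT f ->
  measurable_fun setT (fun w => c *: f w).
Proof.
move=> mf; apply: measurable_fun_mx => i j; under eq_fun do rewrite mxE.
apply: measurable_funM => //.
exact: measurableT_comp (measurable_mx_entry i j) mf.
Qed.

(** [Z / sigma] has the law of [C x] with [x] standard Gaussian and [C C^T = 1], where [C] may be
    rectangular; a shift by [v] is lifted to a shift of [x]. *)
Lemma normal_gaussian_shift_law (R : realType) k d (T : measurableType d)
    (P : probability T R) (Z : {RV P >-> 'cV[R]_k}) (sigma : R) : 0 < sigma ->
  is_normal Z 0 (sigma ^+ 2)%:M -> gaussian_shift_law P (fun w => sigma^-1 *: Z w).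
Proof.
move=> s0 [n [A [gamma [gammaP AA Zlaw]]]].
have sn0 : sigma != 0 by rewrite gt_eqF.
pose C := sigma^-1 *: A.
have CC : C *m C^T = 1%:M.
  rewrite /C linearZ/= -scalemxAl -scalemxAr AA scale_scalar_mx scale_scalar_mx.
  by congr (_%:M); field.
have mN := measurable_scalecV sigma^-1 (measurable_funPT Z).
have ZG (phi : 'cV[R]_k -> \bar R) : (forall y, (0 <= phi y)%E) ->
    measurable_fun setT phi ->
    (\int[P]_w phi (sigma^-1 *: Z w)%R = \int[gamma]_x phi (C *m x))%E.
  move=> phi0 mphi.
  have mphi' : measurable_fun setT (fun y : 'cV[R]_k => phi (sigma^-1 *: y)).
    apply: measurableT_comp mphi _; apply: measurable_scalecV.
    exact: measurable_id.
  have mA : measurable_fun setT (fun x : 'cV[R]_n => A *m x + 0).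
    by apply: measurable_cV_addr; exact: measurable_mulmx_cV.
  transitivity (\int[distribution P Z]_y phi (sigma^-1 *: y)%R)%E.
    by apply/esym; apply: ge0_integral_distribution => // y; exact: phi0.
  transitivity (\int[pushforward gamma (fun x : 'cV[R]_n => (A *m x + 0)%R)]_y
      phi (sigma^-1 *: y)%R)%E.
    by apply: eq_measure_integral => B mB _; exact: Zlaw.
  apply: etrans (ge0_integral_pushforward mA gamma measurableT mphi' _) _.
    by move=> y _; exact: phi0.
  by apply: eq_integral => x _; rewrite /= addr0 /C scalemxAl.
move=> v phi phi0 mphi.
have mphiv : measurable_fun setT (fun y : 'cV[R]_k => phi (y + v)).
  by apply: measurableT_comp mphi _; apply: measurable_cV_addr; exact: measurable_id.
pose ew (y : 'cV[R]_k) := (expR (dot v y - nsq v / 2))%:E.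
have mew : measurable_fun setT ew.
  apply/measurable_EFinP; apply: measurableT_comp => //.
  apply: measurable_funB; last exact: measurable_cst.
  exact: measurable_dot.
apply: etrans (ZG (fun y => phi (y + v)) (fun y => phi0 _) mphiv) _.
apply: etrans _ (esym (ZG (fun y => phi y * ew y)%E _ _)); last 2 first.
- by move=> y; rewrite mule_ge0// lee_fin expR_ge0.
- exact: emeasurable_funM.
(* [C u = v], [|u| = |v|] and [u . x = v . C x], so the two exponents coincide. *)
pose u := C^T *m v.
have Cu : C *m u = v by rewrite mulmxA CC mul1mx.
have mphiC : measurable_fun setT (fun x : 'cV[R]_n => phi (C *m x)).
  exact: measurableT_comp mphi (measurable_mulmx_cV C).
have := gaussian_shift gammaP u (phi := fun x => phi (C *m x)) (fun x => phi0 _) mphiC.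
under [in X in X -> _]eq_integral do rewrite mulmxDr Cu.
move=> H; apply: etrans H _; apply: eq_integral => x _.
congr (_ * (expR _)%:E)%E.
rewrite sumrB -/(dot u x) dot_trmx -mulr_suml; congr (_ - _ * _).
by rewrite -nsqE /nsq dot_trmx Cu.
Qed.

Lemma hs_normE (R : realType) k (M : 'M[R]_k) :
  hs_norm M = Num.sqrt (\sum_i \sum_j M i j ^+ 2).
Proof. by rewrite -sqr_hs_norm sqrtr_sqr ger0_norm ?hs_norm_ge0. Qed.

Lemma itg_hs_norm (R : realType) k d (T : measurableType d)
    (P : probability T R) (F : {RV P >-> 'M[R]_k}) :
  mx_integrable P F -> itg P (fun w => hs_norm (F w)).
Proof.
move=> IF.
have I1 : itg P (fun w => \sum_i \sum_j `|F w i j|).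
  by apply: itg_sum => i; apply: itg_sum => j; apply: itg_norm; exact: IF.
apply: (itg_le I1).
  under eq_fun do rewrite hs_normE.
  apply: (measurableT_comp (continuous_measurable_fun (@sqrt_continuous R))).
  apply: measurable_sum => i; apply: measurable_sum => j; apply: measurable_funX.
  exact: itg_measurable (IF i j).
move=> w; rewrite ger0_norm ?hs_norm_ge0//.
set S := \sum_i \sum_j `|F w i j|.
have S0 : 0 <= S by apply: sumr_ge0 => i _; exact: sumr_ge0.
rewrite -ler_sqr ?nnegrE ?hs_norm_ge0// sqr_hs_norm [leRHS]expr2 mulr_suml.
rewrite ler_sum// => i _; rewrite mulr_suml ler_sum// => j _.
rewrite -real_normK ?num_real// expr2 ler_wpM2l//.
rewrite /S (bigD1 i)//= (bigD1 j)//= -addrA lerDl addr_ge0 ?sumr_ge0// => l _.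
exact: sumr_ge0.
Qed.

Lemma M1_lip1 (R : realType) k (g : 'cV[R]_k -> R) : (M1 g <= 1)%E -> lip1 g.
Proof.
move=> gM x y; have [->|xy] := eqVneq x y.
  by rewrite !subrr normr0 enorm_ge0.
have exy : 0 < enorm (x - y).
  rewrite lt_neqAle enorm_ge0 andbT eq_sym -sqrf_eq0 sqr_enorm nsq_eq0.
  by rewrite subr_eq0.
rewrite -[leRHS]mul1r -ler_pdivrMr// -lee_fin; apply: le_trans gM.
by apply: ereal_sup_ubound; exists (x, y).
Qed.

(** Mean value theorem for [psi - phi] and [psi + phi]. The derivative bound is asked for strictly
    inside, since the formula for the interpolation divides by [cos t] and by [sin t]. *)
Lemma ler_norm_increment (R : realType) (phi dphi psi dpsi : R -> R) (a b : R) :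
  a < b -> (forall x : R, is_derive x (1 : R) phi (dphi x)) ->
  (forall x : R, is_derive x (1 : R) psi (dpsi x)) ->
  (forall x, a < x < b -> `|dphi x| <= dpsi x) ->
  `|phi b - phi a| <= psi b - psi a.
Proof.
move=> ab phiP psiP dle.
have mono (s : R) : `|s| = 1 -> s * (phi b - phi a) <= psi b - psi a.
  move=> s1; pose f (x : R) := psi x - s * phi x.
  have fP (x : R) : is_derive x (1 : R) f (dpsi x - s * dphi x).
    have := phiP x => ?; have := psiP x => ?.
    rewrite /f; apply: is_derive_eq.
    by rewrite /GRing.scale/=; ring.
  have cf : {within `[a, b], continuous f}.
    by apply: derivable_within_continuous => x _; have [] := fP x.
  have [c + E] := MVT ab (fun x _ => fP x) cf.
  rewrite in_itv/= => cab.
  have : 0 <= f b - f a.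
    rewrite E mulr_ge0 ?subr_ge0 ?(ltW ab)//.
    apply: le_trans (ler_norm _) _; rewrite normrM s1 mul1r; exact: dle.
  by rewrite /f; lra.
have := mono 1 (normr1 _); have := mono (-1) (normrN1 _).
by rewrite ler_norml mulN1r mul1r => *; apply/andP; split; lra.
Qed.

Lemma ler_dist_approx (R : realType) (a b a' b' K e : R) :
  `|a' - a| <= e / 2 -> `|b' - b| <= e / 2 -> `|b' - a'| <= K ->
  `|a - b| <= K + e.
Proof.
rewrite !ler_norml => /andP[? ?] /andP[? ?] /andP[? ?].
by apply/andP; split; lra.
Qed.

Theorem theorem5 (R : realType) (k : nat)
  (d : measure_display) (T : measurableType d) (P : probability T R)
  (X : {RV P >-> 'cV[R]_k}) (Xe : R -> {RV P >-> 'cV[R]_k})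
  (Xe_law : forall eps : R, 0 < eps -> same_distribution (Xe eps) X)
  (Xe_cvg : \forall w \ae P, Xe eps w @[eps --> 0^'+] --> X w)
  (sigma : R) (sigma_gt0 : 0 < sigma)
  (d' : measure_display) (T' : measurableType d') (P' : probability T' R)
  (Z : {RV P' >-> 'cV[R]_k}) (Z_normal : is_normal Z 0 ((sigma ^+ 2)%:M))
  (lambda : R -> R) (lambda_gt0 : forall eps : R, 0 < eps -> 0 < lambda eps)
  (F : {RV P >-> 'M[R]_k})
  (int_diff : forall eps : R, 0 < eps ->
    mx_integrable P (fun w => Xe eps w - X w))
  (int_diff2 : forall eps : R, 0 < eps ->
    mx_integrable P (fun w => (Xe eps w - X w) *m (Xe eps w - X w)^T))
  (int_F : mx_integrable P F)
  (* versions of the conditional expectations given X *)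
  (E1 : R -> T -> 'cV[R]_k)
  (E1P : forall eps : R, 0 < eps ->
    is_cond_exp X (fun w => Xe eps w - X w) (E1 eps))
  (E2 : R -> T -> 'M[R]_k)
  (E2P : forall eps : R, 0 < eps ->
    is_cond_exp X (fun w => (Xe eps w - X w) *m (Xe eps w - X w)^T) (E2 eps))
  (EF : T -> 'M[R]_k)
  (EFP : is_cond_exp X F EF)
  (hi : cvg_L1_at0 P (fun eps w => (lambda eps)^-1 *: E1 eps w)
                     (fun w => - X w))
  (hii : cvg_L1_at0 P (fun eps w => (2 * lambda eps)^-1 *: E2 eps w)
                      (fun w => (sigma ^+ 2)%:M + EF w))
  (hiii : forall rho : R, 0 < rho ->
    (((lambda eps)^-1)%:E *
      'E_P[fun w => (enorm (Xe eps w - X w) ^+ 2 *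
                     \1_[set v | rho < enorm (Xe eps v - X v) ^+ 2] w)%R])%E
      @[eps --> 0^'+] --> 0%E) :
  (wasserstein X Z <= (sigma^-1)%:E * 'E_P[fun w => hs_norm (F w)])%E.
Proof.
have mX := measurable_funPT X.
have IX := exchangeable_integrable E1P hi.
pose N w := sigma^-1 *: Z w.
have mN : measurable_fun setT N := measurable_scalecV sigma^-1 (measurable_funPT Z).
have shiftN : gaussian_shift_law P' N := normal_gaussian_shift_law sigma_gt0 Z_normal.
have ZN w : Z w = sigma *: N w by rewrite /N scalerA divff ?scale1r// gt_eqF.
have IF := itg_hs_norm int_F.
pose K := Ex P (fun w => hs_norm (F w)).
have -> : 'E_P[fun w => hs_norm (F w)]%E = K%:E by rewrite unlock -Ex_EFin.
apply: ge_ereal_sup => _ [g gM <-].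
have gL := M1_lip1 gM.
have itgZ_lip f : lip1 f -> itg P' (fun w => f (Z w)).
  move=> fL; have [_ _ I0 _] :=
    itg_growth mN shiftN 0 sigma (lip1_measurable fL) (growth_lip1 fL).
  by apply: eq_itg I0 => w; rewrite add0r -ZN.
have IgX := itg_lip1X mX IX gL.
have IgZ := itgZ_lip g gL.
rewrite unlock Ex_EFin// Ex_EFin//.
rewrite -EFinB -EFinM /= lee_fin.
apply/ler_addgt0Pr => e e0; have e20 : 0 < e / 2 by exact: divr_gt0.
(* Smoothing costs [e / 2] at each end of the interpolation; [B] depends on [e] but is absent from
   the final estimate. *)
have [h [p [Q [B [hL hp pQ QB hg]]]]] := lipschitz_C2_approx mN shiftN gL e20.
have pB y i : `|p y i 0| <= 1.
  by rewrite -dot_delta -(enorm_delta R i); exact: C1_lip1_dot hL hp _ _.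
have pG i := growth_bounded (fun y => pB y i).
have IhX := itg_lip1X mX IX hL.
have IhZ := itgZ_lip h hL.
pose Phi t := Ex P (fun w => ou P' N sigma h t (X w)).
have Phi0 : Phi 0 = Ex P (fun w => h (X w)).
  apply: eq_Ex => w; rewrite /ou /avg sin0 cos0 mulr0 scale1r.
  by rewrite -[RHS](Ex_cst P'); apply: eq_Ex => w'; rewrite scale0r addr0.
(* At [pi / 2] the weight of [X] is [cos (pi / 2) = 0], so the outer expectation is that of a
   constant. *)
have Phi1 : Phi (pi / 2) = Ex P' (fun w => h (Z w)).
  rewrite -[RHS](Ex_cst P); apply: eq_Ex => w; rewrite /ou /avg cos_pihalf sin_pihalf.
  by apply: eq_Ex => w'; rewrite scale0r add0r mulr1 -ZN.
have hX : `|Ex P (fun w => h (X w)) - Ex P (fun w => g (X w))| <= e / 2.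
  rewrite -ExB// -[leRHS](Ex_cst P); apply: Ex_norm_le.
  - exact: itg_cst.
  - exact: itg_measurable (itgB IhX IgX).
  - by move=> w; exact: hg.
have hZ : `|Ex P' (fun w => h (Z w)) - Ex P' (fun w => g (Z w))| <= e / 2.
  rewrite -ExB// -[leRHS](Ex_cst P'); apply: Ex_norm_le.
  - exact: itg_cst.
  - exact: itg_measurable (itgB IhZ IgZ).
  - by move=> w; exact: hg.
suff PhiK : `|Phi (pi / 2) - Phi 0| <= sigma^-1 * K.
  by move: PhiK; rewrite Phi0 Phi1; exact: ler_dist_approx hX hZ.
(* The comparison function: its derivative is the target bound on [|h'(t)|] and its increment over
   [[0, pi / 2]] the claimed constant. *)
pose sn (t : R) := sigma^-1 * K * sin t.
have snP (t : R) : is_derive t (1 : R) sn (sigma^-1 * K * cos t).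
  by rewrite /sn; apply: is_derive_eq; rewrite /GRing.scale/=; ring.
have -> : sigma^-1 * K = sn (pi / 2) - sn 0.
  by rewrite /sn sin_pihalf sin0 mulr0 mulr1 subr0.
have pi20 : 0 < (pi : R) / 2 by rewrite divr_gt0 ?pi_gt0.
apply: (ler_norm_increment pi20
  (fun t => Ex_ou_is_derive mN shiftN mX IX sigma_gt0 hL hp t) snP) => t /andP[t0 t1].
have s0 : 0 < sin t.
  by apply: sin_gt0_pi; rewrite t0 (lt_trans t1)// ltr_pdivrMr// mulr_natr mulr2n ltrDl pi_gt0.
have c0 : 0 < cos t by apply: cos_gt0_pihalf; rewrite t1 (lt_trans _ t0)// oppr_lt0.
have sb0 : 0 < sigma * sin t by exact: mulr_gt0.
have fL : lip1 (ou P' N sigma h t) by exact: ou_lip1.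
have fp : C1 (ou P' N sigma h t) (ou_grad P' N sigma p t).
  exact: (C1_avg mN shiftN (cos t) (sigma * sin t) hp (growth_lip1 hL) pB).
have fH i : C1 (fun y => ou_grad P' N sigma p t y i 0) (ou_hess P' N sigma Q t i).
  have := C1Z (cos t) (C1_avg mN shiftN (cos t) (sigma * sin t) (pQ i) (pG i) (QB i)).
  rewrite (_ : (fun y => ou_grad _ _ _ _ _ y _ _) = (fun y => cos t *
    avg P' N (cos t) (sigma * sin t) (fun y => p y i 0) y))//.
  by apply/funext => y; rewrite mxE.
have mQ c i j : measurable_fun setT (fun w => Q i (c + (sigma * sin t) *: N w) j 0).
  exact: measurableT_comp (C1_measurable_grad j (pQ i)) (measurable_affN mN _ _).
have HB i y j : `|ou_hess P' N sigma Q t i y j 0| <= B.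
  rewrite !mxE mulrA normrM -expr2 ger0_norm ?sqr_ge0//.
  have B0 : 0 <= B by apply: le_trans (QB i y j).
  apply: (@le_trans _ _ (cos t ^+ 2 * B)).
    rewrite ler_wpM2l ?sqr_ge0// -[leRHS](Ex_cst P'); apply: Ex_norm_le => //.
    exact: itg_cst.
  by rewrite ler_piMl// exprn_ile1 ?(ltW c0)// cos_le1.
have mH i j : measurable_fun setT (fun y => ou_hess P' N sigma Q t i y j 0).
  exact: C1_measurable_grad j (fH i).
(* [Ex_ou_speed] turns the inner expectation into [tan t] times the generator at [X w1];
   [stein_identity] for [ou t] then replaces its mean by the term in [F]. *)
have -> : Ex P (fun w1 => Ex P' (fun w =>
     dot (p (cos t *: X w1 + (sigma * sin t) *: N w))
       (- sin t *: X w1 + (sigma * cos t) *: N w))) =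
   - (sin t / cos t) * Ex P (fun w => \sum_i \sum_j F w i j *
       ou_hess P' N sigma Q t i (X w) j 0).
  rewrite mulNr -mulrN -(stein_identity Xe_law lambda_gt0 int_diff int_diff2 int_F
    E1P E2P EFP hi hii hiii fL fp fH HB).
  rewrite -ExZ.
    by apply: eq_Ex => w; rewrite (Ex_ou_speed mN shiftN sigma_gt0 hL hp pQ QB).
  apply: itgD.
    have I1 : itg P (fun w => \sum_i ou_grad P' N sigma p t (X w) i 0 * X w i 0).
      apply: itg_sum => i; apply: (itgM_bounded (c := 1)) => //.
        exact: measurableT_comp (C1_measurable_grad i fp) mX.
      by move=> w; rewrite -dot_delta -(enorm_delta R i); exact: C1_lip1_dot fL fp _ _.
    by apply: eq_itg (itgN I1) => w; rewrite dotC.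
  apply/itgZ/itg_sum => i; apply: (@itg_bounded _ _ _ _ B) => //.
  exact: measurableT_comp (mH i i) mX.
have IFw := itgZ (cos t ^+ 2 / (sigma * sin t)) IF.
rewrite mulNr normrN normrM ger0_norm; last by rewrite divr_ge0 ?ltW.
(* [tan t] times [cos^2 t / (sigma sin t)] is [cos t / sigma]: the singularity of the Hessian bound
   at [0] cancels. *)
apply: (@le_trans _ _ (sin t / cos t * (cos t ^+ 2 / (sigma * sin t) * K))); last first.
  by rewrite le_eqVlt; apply/orP; left; apply/eqP; field; rewrite ?gt_eqF.
rewrite ler_wpM2l ?divr_ge0 ?(ltW s0) ?(ltW c0)// -ExZ//.
apply: Ex_norm_le => //.
  apply: measurable_sum => i; apply: measurable_sum => j.
  apply: measurable_funM; first exact: itg_measurable (int_F i j).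
  exact: measurableT_comp (mH i j) mX.
move=> w.
have -> : \sum_i \sum_j F w i j * ou_hess P' N sigma Q t i (X w) j 0 =
  cos t ^+ 2 * \sum_i \sum_j F w i j *
    Ex P' (fun w' => Q i (cos t *: X w + (sigma * sin t) *: N w') j 0).
  rewrite mulr_sumr; apply: eq_bigr => i _; rewrite mulr_sumr; apply: eq_bigr => j _.
  by rewrite !mxE /avg; ring.
rewrite normrM ger0_norm ?sqr_ge0// -mulrA ler_wpM2l ?sqr_ge0//.
exact: (hessian_bound mN shiftN (cos t *: X w) (F w) sb0 (C1_lip1_dot hL hp) pQ QB).
Qed.
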